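(* Let $\Bbbk$ be an algebraically closed field, let $\Lambda$ be a finite dimensional basic $\Bbbk$-algebra, and let $\widehat{\Lambda}$ be the repetitive algebra of $\Lambda$. Let $$\widehat{M}\xrightarrow{\underline{\widehat{h}}}\widehat{M}'\xrightarrow{\underline{\widehat{h}}'}\widehat{M}''\xrightarrow{\underline{\widehat{h}}''}\Omega^{-1}\widehat{M}$$ be an Auslander-Reiten triangle in $\widehat{\Lambda}\text{-}\underline{\mathrm{mod}}$, where $\widehat{M}$, $\widehat{M}'$ and $\widehat{M}''$ have no projective direct summands as objects in $\widehat{\Lambda}\text{-mod}$. Then the following hold. (i) If $\underline{\widehat{h}}$ is stably smonic, then $\underline{\widehat{h}}'$ is stably sepic. (ii) If $\underline{\widehat{h}}$ is stably sepic, then $\underline{\widehat{h}}'$ is stably sirreducible. (iii) If $\underline{\widehat{h}}$ is stably sirreducible, then $\underline{\widehat{h}}'$ is either stably smonic or stably sirreducible.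
   Context: All modules are finitely generated left modules. Let $Q=D\Lambda=\mathrm{Hom}_\Bbbk(\Lambda,\Bbbk)$ with its canonical $\Lambda$-$\Lambda$-bimodule structure. The repetitive algebra $\widehat{\Lambda}$ has underlying space $\left(\bigoplus_{i\in\mathbb{Z}}\Lambda\right)\oplus\left(\bigoplus_{i\in\mathbb{Z}}Q\right)$, with elements $(a_i,\varphi_i)_i$ (almost all $a_i\in\Lambda$, $\varphi_i\in Q$ zero) and product $(a_i,\varphi_i)_i\cdot(b_i,\psi_i)_i=(a_ib_i,a_{i+1}\psi_i+\varphi_ib_i)_i$. The category $\widehat{\Lambda}\text{-mod}$ is described as follows: objects are $\widehat{M}=(M_i,f_i)_{i\in\mathbb{Z}}$ with $M_i$ finitely generated $\Lambda$-modules, almost all zero, and $\Lambda$-morphisms $f_i:Q\otimes_\Lambda M_i\to M_{i+1}$ with $f_{i+1}\circ(\mathrm{id}_Q\otimes f_i)=0$; a morphism $\widehat{h}:\widehat{M}\to\widehat{M}'$ is a sequence $\widehat{h}=(h_i)_{i\in\mathbb{Z}}$ of $\Lambda$-morphisms $h_i:M_i\to M_i'$ (the component morphisms) with $h_{i+1}\circ f_i=f_i'\circ(\mathrm{id}_Q\otimes h_i)$ for all $i$. $\widehat{\Lambda}\text{-mod}$ is a Frobenius category (projectives and injectives coincide). Its stable category $\widehat{\Lambda}\text{-}\underline{\mathrm{mod}}$ has the same objects, and morphisms are morphisms of $\widehat{\Lambda}\text{-mod}$ modulo those factoring through a finitely generated projective-injective $\widehat{\Lambda}$-module; $\underline{\widehat{h}}$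 denotes the class of $\widehat{h}$. It is triangulated with translation functor $\Omega^{-1}$, where $\Omega^{-1}\widehat{M}$ is the cokernel of an injective hull $\widehat{M}\to I(\widehat{M})$; distinguished triangles come from pushouts of $0\to\widehat{M}\to I(\widehat{M})\to\Omega^{-1}\widehat{M}\to 0$ along morphisms $\widehat{h}:\widehat{M}\to\widehat{M}'$ (the standard triangulated structure on the stable category of a Frobenius category). In an additive category, $f:X\to Y$ is a split mono (resp. split epi) if there is $g:Y\to X$ with $g\circ f=\mathrm{id}_X$ (resp. $f\circ g=\mathrm{id}_Y$). The morphism $f$ is irreducible if it is neither a split mono nor a split epi, and whenever $f=v\circ u$, either $u$ is a split mono or $v$ is a split epi. A distinguished triangle $\widehat{M}\xrightarrow{\underline{\widehat{h}}}\widehat{M}'\xrightarrow{\underline{\widehat{h}}'}\widehat{M}''\xrightarrow{\underline{\widehat{h}}''}\Omega^{-1}\widehat{M}$ is an Auslander-Reiten triangle if: $\widehat{M}$ and $\widehat{M}''$ are indecomposable; $\underline{\widehat{h}}''\neq 0$; and every morphism $\underline{\widehat{u}}':\widehat{N}'\to\widehat{M}''$ in $\widehat{\Lambda}\text{-}\underline{\mathrm{mod}}$ that is not a split epi factors as $\underline{\widehat{u}}'=\underline{\widehat{h}}'\circ\underline{\widehat{v}}'$ for some $\underline{\widehat{v}}':\widehat{N}'\to\widehat{M}'$. A morphism $\widehat{h}=(h_i)_i$ in $\widehat{\Lambda}\text{-mod}$ is smonic (resp. sepic) if every $h_i$ is a split mono (resp. split epi) in $\Lambda\text{-mod}$. An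 irreducible morphism $\widehat{h}$ in $\widehat{\Lambda}\text{-mod}$ is sirreducible if there is $i_0\in\mathbb{Z}$ such that $h_{i_0}$ is neither a split mono nor a split epi, this $i_0$ is unique, and $h_{i_0}$ is irreducible in $\Lambda\text{-mod}$. For an irreducible morphism $\underline{\widehat{h}}:\widehat{M}\to\widehat{M}'$ in $\widehat{\Lambda}\text{-}\underline{\mathrm{mod}}$ with $\widehat{M}$ or $\widehat{M}'$ indecomposable and neither having projective direct summands, $\underline{\widehat{h}}$ is called stably smonic (resp. stably sepic, stably sirreducible) if $\widehat{h}$ is smonic (resp. sepic, sirreducible) in $\widehat{\Lambda}\text{-mod}$. *)

(* Defs.v *)
From HB Require Import structures.
From mathcomp Require Import all_boot all_order all_algebra all_field.
From mathcomp Require Import boolp.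
From mathcomp Require Import freeg.

Set Implicit Arguments.
Unset Strict Implicit.
Unset Printing Implicit Defensive.

Import GRing.Theory.
Local Open Scope ring_scope.
Local Open Scope quotient_scope.

Section Dual.
Variables (k : fieldType) (A : falgType k).

Definition dual := 'Hom(A, k^o).

(* (a phi)(x) = phi (x a) and (phi a)(x) = phi (a x) *)
Definition dual_lact (a : A) (phi : dual) : dual := (phi \o amulr a)%VF.
Definition dual_ract (phi : dual) (a : A) : dual := (phi \o amull a)%VF.

Lemma dual_lactE a phi x : dual_lact a phi x = phi (x * a).
Proof. by rewrite comp_lfunE lfunE. Qed.

Lemma dual_ractE phi a x : dual_ract phi a x = phi (a * x).
Proof. by rewrite comp_lfunE lfunE. Qed.

End Dual.

(* [tens M] is DA (x)_A M: the quotient of the free abelian group on DA * M by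
   the subgroup generated by the biadditivity and A-balancedness relations. *)

Section Tensor.
Variables (k : fieldType) (A : falgType k) (M : lmodType A).

Definition tens_free := {freeg (dual A * M)%type}.

Inductive tens_gen : tens_free -> Prop :=
| TensDl p q m : tens_gen (<< (p + q, m) >> - << (p, m) >> - << (q, m) >>)
| TensDr p m n : tens_gen (<< (p, m + n) >> - << (p, m) >> - << (p, n) >>)
| TensA p a m : tens_gen (<< (dual_ract p a, m) >> - << (p, a *: m) >>).

Definition tens_rel : {pred tens_free} := fun x =>
  `[< forall S : tens_free -> Prop,
        S 0 -> (forall y z, S y -> S z -> S (y - z)) ->
        (forall y, tens_gen y -> S y) -> S x >].

Lemma tens_relP x : reflect (forall S : tens_free -> Prop,
  S 0 -> (forall y z, S y -> S z -> S (y - z)) ->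
  (forall y, tens_gen y -> S y) -> S x) (x \in tens_rel).
Proof. exact: asboolP. Qed.

Fact tens_rel_zmod_closed : zmod_closed tens_rel.
Proof.
split=> [|x y /tens_relP Hx /tens_relP Hy]; first by apply/tens_relP.
by apply/tens_relP => S S0 SB Sg; apply: (SB); [exact: Hx | exact: Hy].
Qed.
HB.instance Definition _ :=
  GRing.isZmodClosed.Build tens_free tens_rel tens_rel_zmod_closed.

Definition tens := {ideal_quot tens_rel}.
HB.instance Definition _ := GRing.Zmodule.on tens.

Definition pure (p : dual A) (m : M) : tens := \pi_tens << (p, m) >>.



Fact tens_pi_additive : additive (\pi_tens : tens_free -> tens).
Proof.
by move=> x y; rewrite (@pi_addr _ _ _ _ _ tens) (@pi_oppr _ _ _ _ _ tens).
Qed.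

Lemma tens_gen0 x : tens_gen x -> \pi_tens x = 0.
Proof.
move=> gx; rewrite -(@pi_zeror _ _ _ _ _ tens); apply/eqmodP.
by rewrite /= /Quotient.equiv subr0; apply/tens_relP => S _ _; apply.
Qed.

Lemma pureDl p q m : pure (p + q) m = pure p m + pure q m.
Proof.
apply/eqP; rewrite -subr_eq0 opprD addrA /pure -!tens_pi_additive.
by apply/eqP/tens_gen0/TensDl.
Qed.

Lemma pureDr p m n : pure p (m + n) = pure p m + pure p n.
Proof.
apply/eqP; rewrite -subr_eq0 opprD addrA /pure -!tens_pi_additive.
by apply/eqP/tens_gen0/TensDr.
Qed.

Lemma pureA p a m : pure (dual_ract p a) m = pure p (a *: m).
Proof.
apply/eqP; rewrite -subr_eq0 /pure -!tens_pi_additive.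
by apply/eqP/tens_gen0/TensA.
Qed.

Record balanced (V : zmodType) (b : dual A -> M -> V) : Prop := Balanced {
  balDl : forall p q m, b (p + q) m = b p m + b q m;
  balDr : forall p m n, b p (m + n) = b p m + b p n;
  balA : forall p a m, b (dual_ract p a) m = b p (a *: m) }.

Definition tens_lift_free (V : zmodType) (b : dual A -> M -> V) : tens_free -> V :=
  fglift (fun x => b x.1 x.2 : zmodule V).

Definition tens_lift (V : zmodType) (b : dual A -> M -> V) (t : tens) : V :=
  tens_lift_free b (repr t).

Section Lift.
Variables (V : zmodType) (b : dual A -> M -> V).

Let lift_freeB : additive (tens_lift_free b).
Proof. exact: (lift_is_additive (fun x => b x.1 x.2 : zmodule V)). Qed.

Let lift_free1 p m : tens_lift_free b << (p, m) >> = b p m.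
Proof. exact: (liftU (fun x => b x.1 x.2 : zmodule V) 1 (p, m)). Qed.

Hypothesis hb : balanced b.

Lemma tens_lift_pi x : tens_lift b (\pi_tens x) = tens_lift_free b x.
Proof.
apply/eqP; rewrite -subr_eq0 -lift_freeB; apply/eqP.
have : repr (\pi_tens x) - x \in tens_rel.
  have /eqmodP := reprK (\pi_tens x).
  by rewrite /= /Quotient.equiv.
move/tens_relP => /(_ (fun y => tens_lift_free b y = 0)); apply.
- by rewrite -[0]subr0 lift_freeB subrr.
- by move=> y z hy hz; rewrite lift_freeB hy hz subr0.
- move=> y [p q m|p m n|p a m]; rewrite !lift_freeB !lift_free1.
  + by rewrite (balDl hb) addrAC addrK subrr.
  + by rewrite (balDr hb) addrAC addrK subrr.
  + by rewrite (balA hb) subrr.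
Qed.

Lemma tens_lift_is_additive : additive (tens_lift b).
Proof.
move=> x y; rewrite -[x]reprK -[y]reprK -tens_pi_additive !tens_lift_pi.
exact: lift_freeB.
Qed.

Lemma tens_liftE p m : tens_lift b (pure p m) = b p m.
Proof. by rewrite /pure tens_lift_pi lift_free1. Qed.

End Lift.

Lemma tens_ind (P : tens -> Prop) :
  (forall p m, P (pure p m)) -> (forall x y, P x -> P y -> P (x - y)) ->
  forall t, P t.
Proof.
move=> Ppure PB t.
have P0 : P 0 by rewrite -(subrr (pure 0 0)); apply: PB.
have PN x : P x -> P (- x) by move=> Px; rewrite -sub0r; apply: PB.
have PD x y : P x -> P y -> P (x + y).
  by move=> Px Py; rewrite -[y]opprK; apply: PB => //; apply: PN.
have piD x y : \pi_tens (x + y) = \pi_tens x + \pi_tens y.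
  exact: (@pi_addr _ _ _ _ _ tens).
rewrite -[t]reprK -(freeg_sumE (repr t)).
elim: (dom _) => [|[p m] s IHs]; first by rewrite big_nil (@pi_zeror _ _ _ _ _ tens).
rewrite big_cons piD; apply: (PD) => // {IHs}; set c := coeff _ _.
have -> : << c *g (p, m) >> = << (p, m) >> *~ c :> tens_free.
  by rewrite freegU_mulz intz.
have Pn n : P (\pi_tens (<< (p, m) >> *+ n)).
  elim: n => [|n IHn]; first by rewrite mulr0n (@pi_zeror _ _ _ _ _ tens).
  by rewrite mulrS piD; apply: (PD) => //; apply: Ppure.
case: c => n; first exact: Pn.
by rewrite NegzE mulrNz (@pi_oppr _ _ _ _ _ tens); apply: PN; apply: Pn.
Qed.

Lemma tens_ext (V : zmodType) (f g : tens -> V) : additive f -> additive g ->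
  (forall p m, f (pure p m) = g (pure p m)) -> f =1 g.
Proof.
move=> fB gB fg; elim/tens_ind => // x y fgx fgy.
by rewrite fB gB fgx fgy.
Qed.

Definition tens_scale (a : A) : tens -> tens :=
  tens_lift (fun p m => pure (dual_lact a p) m).

Fact tens_scale_balanced a : balanced (fun p m => pure (dual_lact a p) m).
Proof.
split=> [p q m|p m n|p b m]; last 2 first.
- exact: pureDr.
- rewrite -pureA; congr pure; apply/lfunP => x.
  by rewrite dual_ractE !dual_lactE dual_ractE mulrA.
rewrite -pureDl; congr pure; apply/lfunP => x.
by rewrite add_lfunE !dual_lactE add_lfunE.
Qed.

Lemma tens_scaleE a p m : tens_scale a (pure p m) = pure (dual_lact a p) m.
Proof. exact: (tens_liftE (tens_scale_balanced a)). Qed.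

Let scaleB a : additive (tens_scale a).
Proof. exact: tens_lift_is_additive (tens_scale_balanced a). Qed.

Fact tens_scaleA a b t : tens_scale a (tens_scale b t) = tens_scale (a * b) t.
Proof.
elim/tens_ind: t => [p m|x y hx hy]; last by rewrite !scaleB hx hy.
rewrite !tens_scaleE; congr pure; apply/lfunP => x.
by rewrite !dual_lactE mulrA.
Qed.

Fact tens_scale1 t : tens_scale 1 t = t.
Proof.
elim/tens_ind: t => [p m|x y hx hy]; last by rewrite !scaleB hx hy.
rewrite !tens_scaleE; congr pure; apply/lfunP => x.
by rewrite !dual_lactE mulr1.
Qed.

Fact tens_scaleDr a x y : tens_scale a (x + y) = tens_scale a x + tens_scale a y.
Proof.
have sN z : tens_scale a (- z) = - tens_scale a z.
  by rewrite -[- z]sub0r scaleB -(subrr 0) scaleB subrr sub0r.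
by rewrite -[y in LHS]opprK scaleB sN opprK.
Qed.

Fact tens_scaleDl t a b : tens_scale (a + b) t = tens_scale a t + tens_scale b t.
Proof.
elim/tens_ind: t => [p m|x y hx hy].
  rewrite !tens_scaleE -pureDl; congr pure; apply/lfunP => x.
  by rewrite add_lfunE !dual_lactE mulrDr linearD.
by rewrite !scaleB hx hy opprD addrACA.
Qed.

HB.instance Definition _ := GRing.Zmodule_isLmodule.Build A tens
  tens_scaleA tens_scale1 tens_scaleDr tens_scaleDl.

Lemma scale_pure a p m : a *: pure p m = pure (dual_lact a p) m :> tens.
Proof. exact: tens_scaleE. Qed.

End Tensor.

Section TensorMap.
Variables (k : fieldType) (A : falgType k).

Section Def.
Variables (M N : lmodType A) (h : {linear M -> N}).

Definition tens_map : tens M -> tens N := tens_lift (fun p m => pure p (h m)).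

Fact tens_map_balanced : balanced (fun p (m : M) => pure p (h m)).
Proof.
split=> [p q m|p m n|p a m]; first exact: pureDl.
- by rewrite linearD pureDr.
- by rewrite pureA linearZ.
Qed.

Lemma tens_mapE p m : tens_map (pure p m) = pure p (h m).
Proof. exact: (tens_liftE tens_map_balanced). Qed.

Let mapB : additive tens_map.
Proof. exact: tens_lift_is_additive tens_map_balanced. Qed.

Fact tens_map_scalable : scalable tens_map.
Proof.
move=> a; elim/tens_ind => [p m|x y hx hy].
  by rewrite scale_pure !tens_mapE scale_pure.
by rewrite scalerBr !mapB hx hy scalerBr.
Qed.

HB.instance Definition _ := GRing.isZmodMorphism.Build _ _ tens_map mapB.
HB.instance Definition _ := GRing.isScalable.Build _ _ _ _ tens_map tens_map_scalable.

End Def.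

Lemma tens_map_id (M : lmodType A) : tens_map (idfun : {linear M -> M}) =1 id.
Proof.
by elim/tens_ind => [p m|x y hx hy]; rewrite ?tens_mapE // linearB /= hx hy.
Qed.

Lemma tens_map_comp (M N P : lmodType A) (g : {linear N -> P}) (f : {linear M -> N}) :
  tens_map (g \o f : {linear M -> P}) =1 tens_map g \o tens_map f.
Proof.
by elim/tens_ind => [p m|x y hx hy] /=; rewrite ?tens_mapE // !linearB /= hx hy.
Qed.

Lemma tens_mapD (M N : lmodType A) (f g : {linear M -> N}) :
  tens_map (f \+ g : {linear M -> N}) =1 tens_map f \+ tens_map g.
Proof.
elim/tens_ind => [p m|x y hx hy] /=; first by rewrite !tens_mapE /= pureDr.
by rewrite !linearB /= hx hy opprD addrACA.
Qed.

Lemma tens_map0 (M N : lmodType A) : tens_map (\0 : {linear M -> N}) =1 \0.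
Proof.
elim/tens_ind => [p m|x y hx hy] /=; last by rewrite linearB /= hx hy subr0.
by rewrite tens_mapE /=; apply: (addrI (pure p 0)); rewrite -pureDr !addr0.
Qed.

End TensorMap.

Section Basic.
Variables (k : fieldType) (A : falgType k).

(* The left ideal of the x with x e = x; it is A e when e is idempotent. *)
Definition left_ideal_pred (e : A) : {pred A^o} := fun x => x * e == x.

Fact left_ideal_submod_closed e : submod_closed (left_ideal_pred e).
Proof.
split=> [|a x y]; first by rewrite unfold_in mul0r.
by rewrite !unfold_in => /eqP hx /eqP hy; rewrite mulrDl -mulrA hx hy.
Qed.
HB.instance Definition _ e :=
  GRing.isSubmodClosed.Build A A^o (left_ideal_pred e) (left_ideal_submod_closed e).

Record left_ideal (e : A) := LeftIdeal {
  left_ideal_val :> A^o;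
  left_ideal_valP : left_ideal_val \in left_ideal_pred e }.
HB.instance Definition _ e := [isSub for @left_ideal_val e].
HB.instance Definition _ e := [Choice of left_ideal e by <:].
HB.instance Definition _ e := [SubChoice_isSubLmodule of left_ideal e by <:].

Definition module_iso (M N : lmodType A) : Prop :=
  exists f : {linear M -> N}, bijective f.

Definition primitive_idempotent (e : A) : Prop :=
  [/\ e != 0, e * e = e &
      forall u v, u * u = u -> v * v = v -> u * v = 0 -> v * u = 0 ->
        e = u + v -> u = 0 \/ v = 0].

(* A is the direct sum of the pairwise non-isomorphic indecomposable projective
   modules A e_i. *)
Definition basic_algebra : Prop :=
  exists (n : nat) (e : 'I_n -> A),
    [/\ forall i, primitive_idempotent (e i),
        forall i j, i != j -> e i * e j = 0,
        \sum_i e i = 1 &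
        forall i j, i != j -> ~ module_iso (left_ideal (e i)) (left_ideal (e j))].

End Basic.

(* Only the data of an additive category that enter the definitions below are
   recorded, without the laws. Morphisms are compared by [ceq], so that a
   quotient category is obtained by coarsening [ceq]. *)

Record addcat := AddCat {
  ob : Type;
  hom : ob -> ob -> Type;
  ceq : forall X Y, hom X Y -> hom X Y -> Prop;
  cid : forall X, hom X X;
  ccomp : forall X Y Z, hom Y Z -> hom X Y -> hom X Z;
  cadd : forall X Y, hom X Y -> hom X Y -> hom X Y;
  czero : forall X Y, hom X Y }.

Arguments hom : clear implicits.
Arguments cid : clear implicits.
Arguments ceq {C X Y} : rename.
Arguments ccomp {C X Y Z} : rename.
Arguments cadd {C X Y} : rename.
Arguments czero {C X Y} : rename.

Section Category.
Variable C : addcat.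
Local Notation "f =c g" := (ceq f g) (at level 70).
Local Notation "g ** f" := (ccomp g f) (at level 40, left associativity).

Definition split_mono (X Y : ob C) (f : hom C X Y) : Prop :=
  exists g : hom C Y X, g ** f =c cid C X.

Definition split_epi (X Y : ob C) (f : hom C X Y) : Prop :=
  exists g : hom C Y X, f ** g =c cid C Y.

Definition isomorphism (X Y : ob C) (f : hom C X Y) : Prop :=
  exists g : hom C Y X, g ** f =c cid C X /\ f ** g =c cid C Y.

Definition irreducible (X Y : ob C) (f : hom C X Y) : Prop :=
  [/\ ~ split_mono f, ~ split_epi f &
      forall (Z : ob C) (u : hom C X Z) (v : hom C Z Y),
        f =c v ** u -> split_mono u \/ split_epi v].

Definition is_zero (X : ob C) : Prop := cid C X =c czero.

Definition is_biproduct (X Y Z : ob C) : Prop :=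
  exists (i1 : hom C Y X) (i2 : hom C Z X) (p1 : hom C X Y) (p2 : hom C X Z),
    [/\ p1 ** i1 =c cid C Y, p2 ** i2 =c cid C Z,
        p1 ** i2 =c czero, p2 ** i1 =c czero &
        cadd (i1 ** p1) (i2 ** p2) =c cid C X].

Definition indecomposable (X : ob C) : Prop :=
  ~ is_zero X /\
  forall Y Z, is_biproduct X Y Z -> is_zero Y \/ is_zero Z.

Definition is_pushout (X Y I P : ob C)
    (i : hom C X I) (f : hom C X Y) (j : hom C I P) (g : hom C Y P) : Prop :=
  j ** i =c g ** f /\
  forall (Z : ob C) (a : hom C I Z) (b : hom C Y Z), a ** i =c b ** f ->
    exists c : hom C P Z,
      (c ** j =c a /\ c ** g =c b) /\
      forall c' : hom C P Z, c' ** j =c a -> c' ** g =c b -> c' =c c.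

End Category.

Section Modules.
Variables (k : fieldType) (A : falgType k).

Definition finitely_generated (M : lmodType A) : Prop :=
  exists (n : nat) (s : 'I_n -> M), forall x : M,
    exists c : 'I_n -> A, x = \sum_i c i *: s i.

Record fgmod := FgMod {
  fgmod_sort :> lmodType A;
  fgmod_fg : finitely_generated fgmod_sort }.

Definition modA : addcat := {|
  ob := fgmod;
  hom := fun M N => {linear M -> N};
  ceq := fun M N f g => f =1 g;
  cid := fun M => idfun;
  ccomp := fun M N P g f => g \o f;
  cadd := fun M N f g => f \+ g;
  czero := fun M N => \0 |}.

(* A module over the repetitive algebra, as a sequence (M_i, f_i). *)
Record repmod := RepMod {
  rep_comp :> int -> fgmod;
  rep_map : forall i, {linear tens (rep_comp i) -> rep_comp (i + 1)};
  rep_mapK : forall i t, rep_map (i + 1) (tens_map (rep_map i) t) = 0;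
  rep_finite : exists n : nat, forall i : int,
    (n < `|i|)%N -> forall x : rep_comp i, x = 0 }.

Record repmor (X Y : repmod) := RepMor {
  mor_comp :> forall i : int, {linear X i -> Y i};
  mor_comm : forall i t,
    mor_comp (i + 1) (rep_map X i t) = rep_map Y i (tens_map (mor_comp i) t) }.

Definition rep_id (X : repmod) : repmor X X.
Proof.
exists (fun i => idfun : {linear X i -> X i}) => i t.
by rewrite tens_map_id.
Defined.

Definition rep_comp_mor (X Y Z : repmod) (g : repmor Y Z) (f : repmor X Y) :
  repmor X Z.
Proof.
exists (fun i => g i \o f i : {linear X i -> Z i}) => i t.
by rewrite tens_map_comp /= !mor_comm.
Defined.

Definition rep_add (X Y : repmod) (f g : repmor X Y) : repmor X Y.
Proof.
exists (fun i => f i \+ g i : {linear X i -> Y i}) => i t.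
by rewrite tens_mapD /= linearD !mor_comm.
Defined.

Definition rep_zero (X Y : repmod) : repmor X Y.
Proof.
exists (fun i => \0 : {linear X i -> Y i}) => i t.
by rewrite tens_map0 /= linear0.
Defined.

Definition repA : addcat := {|
  ob := repmod;
  hom := repmor;
  ceq := fun X Y f g => forall i, f i =1 g i;
  cid := rep_id;
  ccomp := rep_comp_mor;
  cadd := rep_add;
  czero := rep_zero |}.

Definition rep_inj (X Y : repmod) (f : repmor X Y) : Prop :=
  forall i, injective (f i).

Definition rep_surj (X Y : repmod) (f : repmor X Y) : Prop :=
  forall i (y : Y i), exists x : X i, f i x = y.

Definition rep_exact (X Y Z : repmod) (f : repmor X Y) (g : repmor Y Z) : Prop :=
  forall i (y : Y i), g i y = 0 <-> exists x : X i, f i x = y.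

Definition projective (P : repmod) : Prop :=
  forall (X Y : repmod) (g : repmor X Y) (f : repmor P Y), rep_surj g ->
    exists f' : repmor P X, @ceq repA _ _ (rep_comp_mor g f') f.

Definition injective_obj (I : repmod) : Prop :=
  forall (X Y : repmod) (g : repmor X Y) (f : repmor X I), rep_inj g ->
    exists f' : repmor Y I, @ceq repA _ _ (rep_comp_mor f' g) f.

Definition no_projective_summand (X : repmod) : Prop :=
  forall P Y : repmod, @is_biproduct repA X P Y -> projective P ->
    @is_zero repA P.

Definition stable_eq (X Y : repmod) (f g : repmor X Y) : Prop :=
  exists (P : repmod) (u : repmor X P) (v : repmor P Y),
    [/\ projective P, injective_obj P &
        forall i x, f i x - g i x = v i (u i x)].

(* Morphisms of the stable category are given by representatives, compared
   modulo those factoring through a projective-injective object. *)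
Definition stabA : addcat := {|
  ob := repmod;
  hom := repmor;
  ceq := stable_eq;
  cid := rep_id;
  ccomp := rep_comp_mor;
  cadd := rep_add;
  czero := rep_zero |}.

Definition injective_hull (X I : repmod) (f : repmor X I) : Prop :=
  [/\ injective_obj I, rep_inj f &
      forall (Y : repmod) (g : repmor I Y), rep_inj (rep_comp_mor g f) -> rep_inj g].

(* 0 -> X -> I(X) -> Omega^-1 X -> 0 *)
Record cosyzygy (X : repmod) := Cosyzygy {
  hull_ob : repmod;
  cosyz : repmod;
  hull_in : repmor X hull_ob;
  hull_out : repmor hull_ob cosyz;
  hull_inP : injective_hull hull_in;
  hull_exact : rep_exact hull_in hull_out;
  hull_outP : rep_surj hull_out }.

(* The value of the translation functor on objects depends on the choice of an
   injective hull of every object. *)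
Definition translation := forall X : repmod, cosyzygy X.

Section Triangles.
Variable T : translation.

Local Notation Om X := (cosyz (T X)).
Local Notation "g ** f" := (rep_comp_mor g f) (at level 40, left associativity).
Local Notation "f =r g" := (@ceq repA _ _ f g) (at level 70).
Local Notation "f =s g" := (@ceq stabA _ _ f g) (at level 70).

(* w represents Omega^-1 a: it is induced by an extension e of a to the chosen
   hulls. Its stable class does not depend on e. *)
Definition translates (X Y : repmod) (a : repmor X Y) (w : repmor (Om X) (Om Y)) : Prop :=
  exists e : repmor (hull_ob (T X)) (hull_ob (T Y)),
    e ** hull_in (T X) =r hull_in (T Y) ** a /\
    w ** hull_out (T X) =r hull_out (T Y) ** e.

Definition standard_triangle (X Y Z : repmod)
    (f : repmor X Y) (g : repmor Y Z) (h : repmor Z (Om X)) : Prop :=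
  exists j : repmor (hull_ob (T X)) Z,
    [/\ @is_pushout repA _ _ _ _ (hull_in (T X)) f j g,
        h ** j =r hull_out (T X) & h ** g =r rep_zero Y (Om X)].

Definition distinguished (X Y Z : repmod)
    (f : repmor X Y) (g : repmor Y Z) (h : repmor Z (Om X)) : Prop :=
  exists (X' Y' Z' : repmod)
         (f' : repmor X' Y') (g' : repmor Y' Z') (h' : repmor Z' (Om X'))
         (a : repmor X X') (b : repmor Y Y') (c : repmor Z Z')
         (w : repmor (Om X) (Om X')),
    [/\ standard_triangle f' g' h',
        [/\ @isomorphism stabA _ _ a, @isomorphism stabA _ _ b &
            @isomorphism stabA _ _ c],
        translates a w &
        [/\ b ** f =s f' ** a, c ** g =s g' ** b & w ** h =s h' ** c]].

Definition AR_triangle (X Y Z : repmod)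
    (f : repmor X Y) (g : repmor Y Z) (h : repmor Z (Om X)) : Prop :=
  [/\ distinguished f g h,
      @indecomposable stabA X /\ @indecomposable stabA Z,
      ~ (h =s rep_zero Z (Om X)) &
      forall (N : repmod) (u : repmor N Z), ~ @split_epi stabA _ _ u ->
        exists v : repmor N Y, u =s g ** v].

End Triangles.

Section Types.
Variables (X Y : repmod) (f : repmor X Y).

Definition smonic : Prop := forall i, @split_mono modA _ _ (f i).

Definition sepic : Prop := forall i, @split_epi modA _ _ (f i).

Definition sirreducible : Prop :=
  @irreducible repA _ _ f /\
  exists i0 : int,
    [/\ ~ @split_mono modA _ _ (f i0), ~ @split_epi modA _ _ (f i0),
        forall i, ~ @split_mono modA _ _ (f i) -> ~ @split_epi modA _ _ (f i) ->
          i = i0 &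
        @irreducible modA _ _ (f i0)].

(* Irreducibility here is that of the class of f in the stable category, while
   smonic, sepic and sirreducible refer to the representative f itself. *)
Definition stable_admissible : Prop :=
  [/\ @irreducible stabA _ _ f,
      @indecomposable stabA X \/ @indecomposable stabA Y,
      no_projective_summand X & no_projective_summand Y].

Definition stably_smonic : Prop := stable_admissible /\ smonic.
Definition stably_sepic : Prop := stable_admissible /\ sepic.
Definition stably_sirreducible : Prop := stable_admissible /\ sirreducible.

End Types.

End Modules.

(* Main.v *)
(** Every module embeds in a finite sum of the projective-injective modules with A
    in degree i - 1 and DA in degree i. So hulls are projective, and the triangle
    M -h-> M' -h'-> M'' satisfies, up to stable equality: h'h ~ 0, every u with
    h'u ~ 0 factors through h, every u with uh ~ 0 through h'. By Fitting's lemma,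
    stable statements lift: an endomorphism factoring through a projective is
    nilpotent on a module without projective summands, and M, M'' have local
    endomorphism rings. Hence h' is irreducible, also in the module category.

    An irreducible morphism is smonic, sepic or sirreducible: factor it through
    the module that equals its source below degree j, its target above j, and an
    arbitrary W in degree j.

    If h is smonic then h' is, up to an automorphism and a split epi, the cokernel
    of h, hence sepic; dually, h' sepic forces h smonic. If h is sepic then h'
    cannot be smonic: let i0 be the least degree where h' is not onto and N the
    submodule of M'' generated by a complement C of the image of h' in degree i0.
    If N is proper, its inclusion factors through h' up to a projective Q, and
    lifting Q along N + (M'' above i0) -> coker h' exhibits N as a
    projective-injective summand of M''. If N = M'', then M' lives in degree
    i0 + 1, and M embeds in a projective module generated in degree i0 that maps
    onto M''; so M vanishes above i0 + 1, and the componentwise sections of h form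
    a section of h. *)

From HB Require Import structures.
Require Import Defs.
From mathcomp Require Import all_boot all_order all_algebra all_field zify.
From mathcomp Require Import boolp.

Set Implicit Arguments.
Unset Strict Implicit.
Unset Printing Implicit Defensive.

Import Order.TTheory GRing.Theory Num.Theory.
Local Open Scope ring_scope.

(** * Linear algebra over the ground field *)

Section Functionals.
Variables (k : fieldType) (A : falgType k) (V : lmodType A).

(** The field k acts on an A-module through the scalars [c%:A], so V gets no second module
    structure. *)
Definition ksubspace (U : V -> Prop) : Prop :=
  U 0 /\ forall c x y, U x -> U y -> U (c%:A *: x + y).

Definition kfunctional (psi : V -> k) : Prop :=
  forall c x y, psi (c%:A *: x + y) = c * psi x + psi y.

Lemma kfunctionalD psi : kfunctional psi -> {morph psi : x y / x + y}.
Proof. by move=> hp x y; have := hp 1 x y; rewrite !scale1r mul1r. Qed.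

Lemma kfunctional0 psi : kfunctional psi -> psi 0 = 0.
Proof.
by move=> hp; apply: (addrI (psi 0)); rewrite -kfunctionalD // !addr0.
Qed.

Lemma kfunctionalZ psi c x : kfunctional psi -> psi (c%:A *: x) = c * psi x.
Proof. by move=> hp; rewrite -[_ *: x]addr0 hp kfunctional0 // addr0. Qed.

Lemma kfunctionalB psi : kfunctional psi -> {morph psi : x y / x - y}.
Proof.
move=> hp x y; rewrite kfunctionalD //; congr (_ + _).
have -> : - y = (-1)%:A *: y by rewrite !scaleN1r.
by rewrite kfunctionalZ // mulN1r.
Qed.

Definition kspan n (w : 'I_n -> V) (v : 'rV[k]_n) : V :=
  \sum_j (v 0 j)%:A *: w j.

Lemma kspanP n (w : 'I_n -> V) c u v :
  kspan w (c *: u + v) = c%:A *: kspan w u + kspan w v.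
Proof.
rewrite /kspan scaler_sumr -big_split /=; apply: eq_bigr => j _.
by rewrite !mxE scalerDl scalerDl scalerA -scalerAl mul1r scalerA.
Qed.

Lemma kspan0 n (w : 'I_n -> V) : kspan w 0 = 0.
Proof. by rewrite /kspan big1 // => j _; rewrite mxE !scale0r. Qed.

Lemma kspanB n (w : 'I_n -> V) u v : kspan w (u - v) = kspan w u - kspan w v.
Proof. have -> : u - v = (- 1) *: v + u by rewrite scaleN1r addrC.
by rewrite kspanP !scaleN1r addrC. Qed.

Lemma kspan_mul n (w : 'I_n -> V) p (B : 'M_(p, n)) v :
  kspan w (v *m B) = kspan (fun i => kspan w (row i B)) v.
Proof.
rewrite mulmx_sum_row [RHS]/kspan.
apply: (big_rec2 (fun x y => kspan w x = y)) => [|i y x _ <-].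
  exact: kspan0.
by rewrite kspanP.
Qed.

(** The products of a k-basis of A with generators of V span V. The zero vector put at [ord_max]
    makes the length a successor, as in the matrices of [peval_kspan]. *)
Lemma kspan_ex : finitely_generated V ->
  exists n (w : 'I_n.+1 -> V), forall x, exists v, x = kspan w v.
Proof.
move=> [n [s hs]].
pose b := vbasis {:A}; pose d := \dim {:A}.
pose N := #|{: 'I_n * 'I_d}|.
pose w (l : 'I_N.+1) : V :=
  if unlift ord_max l is Some l' then
    let: (i, j) := enum_val l' in b`_j *: s i else 0.
exists N, w => x; have [c ->] := hs x.
exists (\row_l if unlift ord_max l is Some l' then
    let: (i, j) := enum_val l' in coord b j (c i) else 0).
rewrite /kspan big_ord_recr /= mxE unlift_none scale0r scale0r addr0.
transitivity (\sum_(p : 'I_n * 'I_d) (coord b p.2 (c p.1))%:A *: (b`_p.2 *: s p.1)).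
  rewrite -(pair_bigA _ (fun i j => (coord b j (c i))%:A *: (b`_j *: s i))) /=.
  apply: eq_bigr => i _.
  rewrite {1}(coord_vbasis (memvf (c i))) scaler_suml; apply: eq_bigr => j _.
  by rewrite scalerA -scalerAl mul1r.
rewrite (reindex (@enum_val _ predT)) /=; last exact/onW_bij/enum_val_bij.
apply: eq_bigr => l _; rewrite mxE /w.
have -> : widen_ord (leqnSn N) l = lift ord_max l.
  by apply: val_inj; rewrite /= /bump leqNgt ltn_ord.
by rewrite liftK; case: (enum_val l).
Qed.

(** Among the matrices whose row space maps into U, one of maximal rank works: joining the line of a
    further row vector that maps into U cannot raise the rank. *)
Lemma ksubspace_mx n (w : 'I_n -> V) (U : V -> Prop) : ksubspace U ->
  exists B : 'M[k]_n, forall v : 'rV_n, U (kspan w v) <-> (v <= B)%MS.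
Proof.
move=> [U0 UP].
pose ok (B : 'M[k]_n) := forall v : 'rV_n, (v <= B)%MS -> U (kspan w v).
have ok0 : exists r, `[< exists2 B, ok B & \rank B = r >].
  exists 0%N; apply/asboolP; exists 0; last by rewrite mxrank0.
  by move=> v; rewrite submx0 => /eqP ->; rewrite kspan0.
have bnd r : `[< exists2 B, ok B & \rank B = r >] -> (r <= n)%N.
  by move=> /asboolP [B _ <-]; apply: rank_leq_row.
case: (ex_maxnP ok0 bnd) => r /asboolP [B okB rB] rmax.
exists B => v; split=> [Uv|]; last exact: okB.
have okBv : ok (B + <<v>>)%MS.
  move=> u /sub_addsmxP [[u1 u2] /= ->].
  have -> : u1 *m B + u2 *m <<v>>%MS = 1 *: (u1 *m B) + u2 *m <<v>>%MS by rewrite scale1r.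
  rewrite kspanP; apply: (UP); first by apply: okB; apply: submxMl.
  have : (u2 *m <<v>>%MS <= v)%MS.
    by rewrite (submx_trans (submxMl _ _)) // genmxE.
  move=> /sub_rVP [a ->].
  by rewrite -[a *: v]addr0 kspanP kspan0; apply: (UP).
have : (\rank (B + <<v>>)%MS <= r)%N.
  by apply: rmax; apply/asboolP; exists (B + <<v>>)%MS.
rewrite -rB => le.
have : (B + <<v>> <= B)%MS.
  by rewrite -(geq_leqif (mxrank_leqif_sup (addsmxSl B <<v>>%MS))).
by rewrite addsmx_sub genmxE => /andP [].
Qed.

(** The functionals are the columns of the cokernel matrix of B, applied to chosen coordinates. Two
    choices of coordinates differ by a relation, which lies in the row space of B because 0 is in
    U. *)
Lemma ksubspace_functionals (U : V -> Prop) :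
  finitely_generated V -> ksubspace U ->
  exists n (psi : 'I_n -> V -> k), (forall l, kfunctional (psi l)) /\
    forall x, U x <-> forall l, psi l x = 0.
Proof.
move=> fgV hU; have [n [w hw]] := kspan_ex fgV.
have [B hB] := ksubspace_mx w hU.
have [lft hl] := choice hw.
have [U0 _] := hU.
exists n.+1, (fun l x => (lft x *m cokermx B) 0 l); split.
  move=> l c x y.
  have : ((lft (c%:A *: x + y) - (c *: lft x + lft y))%R <= B)%MS.
    by apply/hB; rewrite kspanB kspanP -!hl subrr.
  rewrite submxE mulmxBl subr_eq0 => /eqP ->.
  by rewrite mulmxDl -scalemxAl !mxE.
move=> x; rewrite {1}(hl x); split=> [/hB|h].
  by rewrite submxE => /eqP -> l; rewrite mxE.
by apply/hB; rewrite submxE; apply/eqP/rowP => l; rewrite h mxE.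
Qed.

End Functionals.

(** * Submodules and modules over the repetitive algebra *)

Definition mklin (A : pzRingType) (U V : lmodType A) (f : U -> V) (hf : linear f) :
  {linear U -> V} := HB.pack f (GRing.isLinear.Build _ _ _ _ f hf).

Section Submodule.
Variables (k : fieldType) (A : falgType k) (M : lmodType A).

Record submod := Submod {
  sm_mem :> M -> Prop;
  sm0 : sm_mem 0;
  smP : forall a x y, sm_mem x -> sm_mem y -> sm_mem (a *: x + y) }.

Lemma smZ (S : submod) a x : S x -> S (a *: x).
Proof. by move=> Sx; rewrite -[_ *: _]addr0; apply: smP => //; apply: sm0. Qed.

Definition sm_pred (S : submod) : {pred M} := fun x => `[< S x >].

Fact sm_pred_closed S : submod_closed (sm_pred S).
Proof.
split=> [|a x y /asboolP Sx /asboolP Sy]; apply/asboolP; first exact: sm0.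
exact: smP.
Qed.
HB.instance Definition _ S :=
  GRing.isSubmodClosed.Build A M (sm_pred S) (sm_pred_closed S).

Record subm (S : submod) := Subm {
  subm_val :> M;
  subm_valP : subm_val \in sm_pred S }.
HB.instance Definition _ S := [isSub for @subm_val S].
HB.instance Definition _ S := [Choice of subm S by <:].
HB.instance Definition _ S := [SubChoice_isSubLmodule of subm S by <:].

Definition subm_of (S : submod) x (Sx : S x) : subm S :=
  @Subm S x (introT (asboolP _) Sx).

Lemma subm_mem (S : submod) (x : subm S) : S (val x).
Proof. exact/asboolP/(subm_valP x). Qed.

(** In coordinates over k a submodule is the row space of a matrix, and the rows of that matrix
    generate it. *)
Lemma subm_fg (S : submod) :
  finitely_generated M -> finitely_generated (subm S).
Proof.
move=> fgM; have [n [w hw]] := kspan_ex fgM.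
have hS : ksubspace S by split; [exact: sm0 | move=> c x y; apply: smP].
have [B hB] := ksubspace_mx w hS.
have hs i : S (kspan w (row i B)) by apply/hB/row_sub.
exists n.+1, (fun i => subm_of (hs i)) => x.
have [v hv] := hw (val x).
have /hB/submxP[u hu] : S (kspan w v) by rewrite -hv; apply: subm_mem.
exists (fun i => (u 0 i)%:A); apply: val_inj.
by rewrite hv hu kspan_mul /kspan raddf_sum; apply: eq_bigr => i _.
Qed.

Definition fg_subm (S : submod) (fgM : finitely_generated M) : fgmod A :=
  FgMod (subm_fg S fgM).

End Submodule.

(** * The action of DA, elementwise *)

Section Actions.
Variables (k : fieldType) (A : falgType k).
Implicit Types X Y Z : repmod A.

(** Pure tensors generate, so structure maps and morphisms can be handled through this action on
    elements. *)
Definition qact X i (q : dual A) (x : X i) : X (i + 1) := rep_map X i (pure q x).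

Lemma qactDl X i p q (x : X i) : qact (p + q) x = qact p x + qact q x.
Proof. by rewrite /qact pureDl linearD. Qed.

Lemma qactDr X i q (x y : X i) : qact q (x + y) = qact q x + qact q y.
Proof. by rewrite /qact pureDr linearD. Qed.

Lemma qactA X i q a (x : X i) : qact (dual_ract q a) x = qact q (a *: x).
Proof. by rewrite /qact pureA. Qed.

Lemma qact_lact X i q a (x : X i) : qact (dual_lact a q) x = a *: qact q x.
Proof. by rewrite /qact -linearZ /= scale_pure. Qed.

Lemma qact0r X i q : qact q (0 : X i) = 0.
Proof. by apply: (addrI (qact q 0)); rewrite -qactDr !addr0. Qed.

Lemma qact_qact X i p q (x : X i) : qact p (qact q x) = 0.
Proof. by have := rep_mapK (pure p (pure q x)); rewrite tens_mapE. Qed.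

Lemma mor_qact X Y (f : repmor X Y) i q (x : X i) :
  f (i + 1) (qact q x) = qact q (f i x).
Proof. by rewrite /qact mor_comm tens_mapE. Qed.

Definition mkmor X Y (g : forall i, {linear X i -> Y i})
  (hg : forall i q x, g (i + 1) (qact q x) = qact q (g i x)) : repmor X Y.
Proof.
exists g => i; elim/tens_ind => [p m|x y hx hy]; first by rewrite tens_mapE; apply: hg.
by rewrite !linearB /= hx hy.
Defined.

Section Tlin.
Variables (V W : lmodType A) (b : dual A -> V -> W) (hb : balanced b).
Hypothesis hl : forall a q x, b (dual_lact a q) x = a *: b q x.

Fact tlin_linear : linear (tens_lift b).
Proof.
have hB := tens_lift_is_additive hb.
have h0 : tens_lift b 0 = 0 by have := hB 0 0; rewrite !subrr.
have hD x y : tens_lift b (x + y) = tens_lift b x + tens_lift b y.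
  by have := hB x (0 - y); rewrite (hB 0 y) h0 !sub0r !opprK.
move=> a x y; rewrite hD; congr (_ + _).
elim/tens_ind: x => [p m|u v hu hv]; first by rewrite scale_pure !(tens_liftE hb) hl.
by rewrite scalerBr !hB hu hv scalerBr.
Qed.

Definition tlin : {linear tens V -> W} := mklin tlin_linear.

Lemma tlinE p m : tlin (pure p m) = b p m.
Proof. exact: tens_liftE. Qed.
End Tlin.

Lemma balBr (V W : lmodType A) (b : dual A -> V -> W) p x y :
  balanced b -> b p (x - y) = b p x - b p y.
Proof.
move=> hb; apply/eqP; rewrite eq_sym subr_eq -(balDr hb); apply/eqP.
by rewrite subrK.
Qed.

(** By the universal property of the tensor product, these data amount to the structure maps of a
    module over the repetitive algebra. *)
Record qaction (M : int -> fgmod A) := Qaction {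
  qa :> forall i, dual A -> M i -> M (i + 1);
  qa_bal : forall i, balanced (@qa i);
  qa_lact : forall i a q (x : M i), qa (dual_lact a q) x = a *: qa q x :> M (i + 1);
  qa_qa : forall i p q (x : M i), qa p (qa q x) = 0;
  qa_fin : exists n : nat, forall i : int, (n < `|i|)%N -> forall x : M i, x = 0 }.

Definition mkrep (M : int -> fgmod A) (b : qaction M) : repmod A.
Proof.
exists M (fun i => tlin (qa_bal b i) (@qa_lact _ b i)); last exact: qa_fin b.
move=> i; elim/tens_ind => [p m|x y hx hy]; last by rewrite !linearB hx hy subr0.
rewrite tens_mapE tlinE; elim/tens_ind: m => [q m|x y hx hy].
  by rewrite tlinE qa_qa.
by rewrite linearB (balBr _ _ _ (qa_bal b (i + 1))) hx hy subrr.
Defined.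
End Actions.

(** * Subobjects, factorizations and direct sums *)

Section Subobjects.
Variables (k : fieldType) (A : falgType k).
Implicit Types X Y Z : repmod A.

Lemma mkrep_qact (M : int -> fgmod A) (b : qaction M) i q (x : M i) :
  @qact _ _ (mkrep b) i q x = b i q x.
Proof. exact: tlinE. Qed.

Record subrep X := Subrep {
  sr :> forall i, submod (X i);
  sr_qact : forall i q x, sr i x -> sr (i + 1) (qact q x) }.

Fact subob_qaction X (S : subrep X) :
  qaction (fun i => fg_subm (S i) (fgmod_fg (X i))).
Proof.
exists (fun i q x => subm_of (sr_qact q (subm_mem x))).
- move=> i; split=> [p q m|p m n|p a m]; apply: val_inj => /=.
  + exact: qactDl.
  + exact: qactDr.
  + exact: qactA.
- by move=> i a q x; apply: val_inj; apply: qact_lact.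
- by move=> i p q x; apply: val_inj; apply: qact_qact.
- have [n hn] := rep_finite X; exists n => i ni x; apply: val_inj; exact: hn.
Defined.

Definition subob X (S : subrep X) : repmod A := mkrep (subob_qaction S).

Definition subob_in X (S : subrep X) : repmor (subob S) X.
Proof.
apply: (@mkmor _ _ (subob S) X (fun i => val : {linear subm (S i) -> X i})).
by move=> i q x; rewrite mkrep_qact.
Defined.

Lemma subob_in_inj X (S : subrep X) : rep_inj (subob_in S).
Proof. by move=> i; apply: val_inj. Qed.

Lemma subob_inP X (S : subrep X) i (x : X i) :
  (exists y, subob_in S i y = x) <-> S i x.
Proof.
split=> [[y <-]|Sx]; first exact: subm_mem.
by exists (subm_of Sx).
Qed.

Lemma mk_subrep X (P : forall i, X i -> Prop) :
  (forall i, P i 0) -> (forall i a x y, P i x -> P i y -> P i (a *: x + y)) ->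
  (forall i q x, P i x -> P (i + 1) (qact q x)) ->
  exists S : subrep X, forall i x, S i x <-> P i x.
Proof.
move=> P0 PP Pq.
by exists (@Subrep X (fun i => Submod (P0 i) (PP i)) Pq).
Qed.

Lemma kernel_subrep X Y (f : repmor X Y) :
  exists S : subrep X, forall i x, S i x <-> f i x = 0.
Proof.
apply: (@mk_subrep X (fun i x => f i x = 0)) => [i|i a x y hx hy|i q x hx].
- exact: linear0.
- by rewrite linearP hx hy scaler0 addr0.
- by rewrite mor_qact hx qact0r.
Qed.

Lemma image_subrep X Y (f : repmor X Y) :
  exists S : subrep Y, forall i y, S i y <-> exists x, f i x = y.
Proof.
apply: (@mk_subrep Y (fun i y => exists x, f i x = y)).
- by move=> i; exists 0; apply: linear0.
- by move=> i a _ _ [x <-] [y <-]; exists (a *: x + y); apply: linearP.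
- by move=> i q _ [x <-]; exists (qact q x); apply: mor_qact.
Qed.

(** Preimages under [m] are unique, so choosing them is linear and commutes with DA. *)
Lemma factor_mono X Y Z (m : repmor Y X) (g : repmor Z X) : rep_inj m ->
  (forall i z, exists y, m i y = g i z) ->
  exists g' : repmor Z Y, forall i z, m i (g' i z) = g i z.
Proof.
move=> mI hg.
have [h hh] : exists h : forall i, Z i -> Y i, forall i z, m i (h i z) = g i z.
  exists (fun i z => sval (cid (hg i z))) => i z.
  by case: (cid _).
have hl i : linear (h i).
  by move=> a x y; apply: mI; rewrite linearP !hh linearP.
have hq i q x : mklin (hl (i + 1)) (qact q x) = qact q (mklin (hl i) x).
  by apply: mI; rewrite mor_qact !hh mor_qact.
by exists (mkmor hq).
Qed.

(** Two preimages of a point under [p] differ by an element killed by [g], so [g] after any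
    set-theoretic section of [p] is a morphism. *)
Lemma factor_epi X Y C (p : repmor X C) (g : repmor X Y) : rep_surj p ->
  (forall i x, p i x = 0 -> g i x = 0) ->
  exists g' : repmor C Y, forall i x, g' i (p i x) = g i x.
Proof.
move=> pS hg.
have [h hh] : exists h : forall i, C i -> X i, forall i c, p i (h i c) = c.
  exists (fun i c => sval (cid (pS i c))) => i c.
  by case: (cid _).
have gE i x y : p i x = p i y -> g i x = g i y.
  move=> e; apply/eqP; rewrite -subr_eq0 -linearB; apply/eqP/hg.
  by rewrite linearB e subrr.
have hl i : linear (fun c => g i (h i c)).
  by move=> a x y /=; rewrite -linearP; apply: gE; rewrite linearP !hh.
have hq i q x : mklin (hl (i + 1)) (qact q x) = qact q (mklin (hl i) x).
  by rewrite /= -mor_qact; apply: gE; rewrite mor_qact !hh.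
by exists (mkmor hq) => i x; apply: gE; rewrite hh.
Qed.

Section Dsum.
Variables X Y : repmod A.

Lemma prod_fg (M N : lmodType A) : finitely_generated M -> finitely_generated N ->
  finitely_generated (M * N)%type.
Proof.
move=> [m [s hs]] [n [t ht]].
exists (m + n)%N, (fun i => match split i with inl j => (s j, 0) | inr j => (0, t j) end).
move=> [x y]; have [c hc] := hs x; have [d hd] := ht y.
exists (fun i => match split i with inl j => c j | inr j => d j end).
rewrite big_split_ord /=.
under eq_bigr => i _ do rewrite (unsplitK (inl i)).
under [X in _ + X]eq_bigr => i _ do rewrite (unsplitK (inr i)).
rewrite [LHS]surjective_pairing [RHS]surjective_pairing /=.
rewrite !raddf_sum /=; congr (_, _).
  by rewrite [X in _ + X]big1 ?addr0 // => i _; rewrite scaler0.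
by rewrite [X in X + _]big1 ?add0r // => i _; rewrite scaler0.
Qed.

Fact dsum_qaction :
  qaction (fun i => FgMod (prod_fg (fgmod_fg (X i)) (fgmod_fg (Y i)))).
Proof.
exists (fun i q x => (qact q x.1, qact q x.2)).
- by move=> i; split=> [p q m|p m n|p a m]; rewrite /= ?qactDl ?qactDr ?qactA.
- by move=> i a q x; rewrite !qact_lact.
- by move=> i p q x; rewrite !qact_qact.
- have [m hm] := rep_finite X; have [n hn] := rep_finite Y.
  exists (m + n)%N => i mni [x y]; congr (_, _).
    by apply: hm; apply: leq_ltn_trans mni; apply: leq_addr.
  by apply: hn; apply: leq_ltn_trans mni; apply: leq_addl.
Defined.

Definition dsum : repmod A := mkrep dsum_qaction.

Definition dsum_fst : repmor dsum X.
Proof.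
apply: (@mkmor _ _ dsum X (fun i => fst : {linear (X i * Y i)%type -> X i})).
by move=> i q x; rewrite mkrep_qact.
Defined.

Definition dsum_snd : repmor dsum Y.
Proof.
apply: (@mkmor _ _ dsum Y (fun i => snd : {linear (X i * Y i)%type -> Y i})).
by move=> i q x; rewrite mkrep_qact.
Defined.

Fact dsum_pair_linear Z (f : repmor Z X) (g : repmor Z Y) i :
  linear (fun z => (f i z, g i z)).
Proof. by move=> a x y; rewrite !linearP. Qed.

Definition dsum_pair Z (f : repmor Z X) (g : repmor Z Y) : repmor Z dsum.
Proof.
refine (@mkmor k A Z dsum
  (fun i => mklin (@dsum_pair_linear Z f g i) : {linear Z i -> dsum i}) _).
by move=> i q x; rewrite mkrep_qact /= !mor_qact.
Defined.

Fact dsum_case_linear Z (f : repmor X Z) (g : repmor Y Z) i :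
  linear (fun x : X i * Y i => f i x.1 + g i x.2).
Proof. by move=> a x y; rewrite !linearP /= scalerDr addrACA. Qed.

Definition dsum_case Z (f : repmor X Z) (g : repmor Y Z) : repmor dsum Z.
Proof.
refine (@mkmor k A dsum Z
  (fun i => mklin (@dsum_case_linear Z f g i) : {linear dsum i -> Z i}) _).
by move=> i q x; rewrite mkrep_qact /= qactDr !mor_qact.
Defined.
End Dsum.

Definition projinj X := projective X /\ injective_obj X.

Lemma projective_dsum X Y : projective X -> projective Y -> projective (dsum X Y).
Proof.
move=> pX pY U V g f gS.
have [f1 h1] := pX _ _ _ (rep_comp_mor f (dsum_pair (rep_id X) (rep_zero X Y))) gS.
have [f2 h2] := pY _ _ _ (rep_comp_mor f (dsum_pair (rep_zero Y X) (rep_id Y))) gS.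
exists (dsum_case f1 f2) => i [x y] /=; rewrite linearD.
have /= -> := h1 i x; have /= -> := h2 i y.
by rewrite -linearD /=; congr (f i (_, _)); rewrite ?addr0 ?add0r.
Qed.

Lemma injective_dsum X Y :
  injective_obj X -> injective_obj Y -> injective_obj (dsum X Y).
Proof.
move=> iX iY U V g f gI.
have [f1 h1] := iX _ _ _ (rep_comp_mor (dsum_fst X Y) f) gI.
have [f2 h2] := iY _ _ _ (rep_comp_mor (dsum_snd X Y) f) gI.
exists (dsum_pair f1 f2) => i x /=.
have /= -> := h1 i x; have /= -> := h2 i x.
by rewrite -surjective_pairing.
Qed.

Lemma projinj_dsum X Y : projinj X -> projinj Y -> projinj (dsum X Y).
Proof.
by move=> [pX iX] [pY iY]; split; [apply: projective_dsum | apply: injective_dsum].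
Qed.

Lemma projective_retract X P (i : repmor X P) (p : repmor P X) :
  (forall j x, p j (i j x) = x) -> projective P -> projective X.
Proof.
move=> pi pP U V g f gS.
have [f' hf'] := pP _ _ _ (rep_comp_mor f p) gS.
exists (rep_comp_mor f' i) => j x /=.
by have /= -> := hf' j (i j x); rewrite pi.
Qed.

Lemma injective_retract X P (i : repmor X P) (p : repmor P X) :
  (forall j x, p j (i j x) = x) -> injective_obj P -> injective_obj X.
Proof.
move=> pi iP U V g f gI.
have [f' hf'] := iP _ _ _ (rep_comp_mor i f) gI.
exists (rep_comp_mor p f') => j x /=.
by have /= -> := hf' j x; rewrite pi.
Qed.

Lemma projinj_retract X P (i : repmor X P) (p : repmor P X) :
  (forall j x, p j (i j x) = x) -> projinj P -> projinj X.
Proof.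
move=> pi [pP iP]; split; first exact: projective_retract pi pP.
exact: injective_retract pi iP.
Qed.
End Subobjects.

(** * Elementary projective-injective modules *)

(** Every integer is a successor, so a family may be prescribed at successors; the transport along
    [j - 1 + 1 = j] stays inside this proof. *)
Lemma shift_family (T : int -> Type) (G : forall j, T (j + 1)) :
  exists F : forall j, T j, forall j, F (j + 1) = G j.
Proof.
exists (fun j => eq_rect _ T (G (j - 1)) j (subrK 1 j)) => j.
move: (subrK 1 (j + 1)); have : j + 1 - 1 = j := addrK 1 j.
move: (j + 1 - 1) => j' e; subst j' => e'.
by rewrite (eq_irrelevance e' erefl).
Qed.

Section DualModule.
Variables (k : fieldType) (A : falgType k).

(** Biduality for the finite dimensional A: the coordinates of [a] are the values of [theta] on the
    dual basis [cf]. *)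
Lemma dual_evaluation (theta : dual A -> k) :
  (forall c p q, theta (c *: p + q) = c * theta p + theta q) ->
  exists a, forall q : dual A, theta q = q a.
Proof.
move=> ht.
have h0 : theta 0 = 0.
  by apply: (addrI (theta 0)); rewrite -{1}[theta 0]mul1r -ht scale1r !addr0.
pose b := vbasis {:A}.
pose cf i : dual A := linfun (coord b i : A -> k^o).
have cfE i x : cf i x = coord b i x by rewrite lfunE.
exists (\sum_i theta (cf i) *: b`_i) => q.
have -> : q = \sum_(i < \dim {:A}) q (b`_i) *: cf i.
  apply/lfunP => x; rewrite sum_lfunE {1}(coord_vbasis (memvf x)) linear_sum.
  by apply: eq_bigr => i _; rewrite linearZ scale_lfunE cfE; apply: mulrC.
rewrite sum_lfunE.
transitivity (\sum_(i < \dim {:A}) q (b`_i) * theta (cf i)).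
  by apply: (big_rec2 (fun u v => theta u = v)) => // i y x _ <-; rewrite ht.
apply: eq_bigr => i _; rewrite scale_lfunE cfE linear_sum /=.
congr (_ * _); rewrite (bigD1 i) //= linearZ /= coord_free ?(basis_free (vbasisP _)) //.
rewrite eqxx mulr1 big1 ?addr0 // => j ji.
by rewrite linearZ /= coord_free ?(basis_free (vbasisP _)) // (negbTE ji) mulr0.
Qed.

Lemma dual_separates (a b : A) : (forall q : dual A, q a = q b) -> a = b.
Proof.
move=> h; pose B := vbasis {:A}.
rewrite (coord_vbasis (memvf a)) (coord_vbasis (memvf b)).
apply: eq_bigr => i _; congr (_ *: _).
by have := h (linfun (coord B i : A -> k^o)); rewrite !lfunE.
Qed.

(** A separate name for DA as a left A-module, since [dual A] already carries the scalar action of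
    k. *)
Definition dualM : Type := dual A.
HB.instance Definition _ := GRing.Zmodule.on dualM.

Fact dualM_scaleA a b (q : dualM) :
  dual_lact a (dual_lact b q) = dual_lact (a * b) q :> dualM.
Proof. by apply/lfunP => x; rewrite !dual_lactE mulrA. Qed.
Fact dualM_scale1 (q : dualM) : dual_lact 1 q = q :> dualM.
Proof. by apply/lfunP => x; rewrite !dual_lactE mulr1. Qed.
Fact dualM_scaleDr a (p q : dualM) :
  dual_lact a (p + q) = dual_lact a p + dual_lact a q :> dualM.
Proof. by apply/lfunP => x; rewrite add_lfunE !dual_lactE add_lfunE. Qed.
Fact dualM_scaleDl (q : dualM) a b :
  dual_lact (a + b) q = dual_lact a q + dual_lact b q :> dualM.
Proof. by apply/lfunP => x; rewrite add_lfunE !dual_lactE mulrDr linearD. Qed.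
HB.instance Definition _ := GRing.Zmodule_isLmodule.Build A dualM
  dualM_scaleA dualM_scale1 dualM_scaleDr dualM_scaleDl.

Lemma dualM_fg : finitely_generated dualM.
Proof.
pose b := vbasis {: dual A}.
exists (\dim {: dual A}), (fun i => b`_i) => q.
exists (fun i => (coord b i q)%:A).
rewrite {1}(coord_vbasis (memvf (q : dual A))); apply: eq_bigr => i _.
apply/lfunP => x; rewrite scale_lfunE dual_lactE.
by rewrite -scalerAr mulr1 linearZ.
Qed.

Lemma regular_fg : finitely_generated A^o.
Proof.
by exists 1%N, (fun=> 1) => x; exists (fun=> x); rewrite big_ord1 -[RHS]/(x * 1) mulr1.
Qed.
End DualModule.

(* A sits in degree [i - 1] and DA in degree [i]; both are cut out of the same
   module [A * DA] in every degree, which avoids transports along [j = i]. *)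
Section ElementaryProjectiveInjective.
Variables (k : fieldType) (A : falgType k) (i : int).
Implicit Types X Y Z : repmod A.

Local Notation AD := (A^o * dualM A)%type.

Definition elempi_mem (j : int) (x : AD) : Prop :=
  (j + 1 <> i -> x.1 = 0) /\ (j <> i -> x.2 = 0).

Fact elempi_mem0 j : elempi_mem j 0. Proof. by []. Qed.

Fact elempi_memP j a x y : elempi_mem j x -> elempi_mem j y ->
  elempi_mem j (a *: x + y).
Proof.
move=> [x1 x2] [y1 y2]; split=> ji /=.
  by rewrite x1 // y1 // scaler0 addr0.
by rewrite x2 // y2 // scaler0 addr0.
Qed.

Definition elempi_sub j := Submod (elempi_mem0 j) (@elempi_memP j).

Fact elempi_act j (q : dual A) (x : subm (elempi_sub j)) :
  elempi_sub (j + 1) (0, dual_ract q (val x).1).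
Proof.
split=> // ji /=; rewrite (subm_mem x).1 //.
by apply/lfunP => y; rewrite dual_ractE mul0r linear0 zero_lfunE.
Qed.

Fact elempi_qaction :
  qaction (fun j => fg_subm (elempi_sub j) (prod_fg (regular_fg A) (dualM_fg A))).
Proof.
exists (fun j q x => subm_of (elempi_act q x)).
- move=> j; split=> [p q m|p m n|p a m]; apply: val_inj; congr (_, _);
    rewrite /= ?addr0 //; apply/lfunP => x.
  + by rewrite add_lfunE !dual_ractE add_lfunE.
  + by rewrite add_lfunE !dual_ractE mulrDl linearD.
  + by rewrite !dual_ractE mulrA.
- move=> j a q x; apply: val_inj; congr (_, _); rewrite /= ?scaler0 //.
  by apply/lfunP => y; rewrite dual_ractE !dual_lactE dual_ractE mulrA.
- move=> j p q x; apply: val_inj; congr (_, _).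
  by apply/lfunP => y; rewrite dual_ractE /= mul0r linear0 zero_lfunE.
- exists (`|i| + 1)%N => j hj x; apply: val_inj.
  have [h1 h2] := subm_mem x.
  rewrite [LHS]surjective_pairing [RHS]surjective_pairing h1 ?h2 //.
    by move=> e; move: hj; rewrite e; lia.
  by move=> e; move: hj; rewrite -e; lia.
Defined.

Definition elempi : repmod A := mkrep elempi_qaction.
End ElementaryProjectiveInjective.

Section Elempi2.
Variables (k : fieldType) (A : falgType k).
Implicit Types X Y Z : repmod A.

Fact elempi_gen_mem i j : elempi_sub A i j (if j + 1 == i then 1 else 0, 0).
Proof. by split=> //= /eqP/negbTE ->. Qed.

Definition elempi_gen i j : elempi A i j := subm_of (elempi_gen_mem i j).

Lemma elempi_qact i j q (x : elempi A i j) :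
  val (qact q x) = (0, dual_ract q (val x).1).
Proof. by rewrite mkrep_qact. Qed.

(** [elempi A i] is free on the unit of A in degree i - 1. A whole family [x] is given, instead of
    one element of degree i - 1, to avoid a transport. *)
Lemma elempi_out i X (x : forall j, X j) :
  exists (m : repmor (elempi A i) X), forall j,
    (forall a : elempi A i j, (val a).2 = 0 -> m j a = (val a).1 *: x j).
Proof.
(* [F j] is the action of DA on [x] in degree j - 1; it gives the values on the component DA. *)
have [F hF] := @shift_family (fun j => dual A -> X j) (fun j q => qact q (x j)).
have FS (P : forall j, (dual A -> X j) -> Prop) :
    (forall j, P (j + 1) (F (j + 1))) -> forall j, P j (F j).
  by move=> h j; have := h (j - 1); rewrite subrK.
have FP : forall j a p q, F j (dual_lact a p + q) = a *: F j p + F j q.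
  apply: (FS (fun j f => forall a p q, f (dual_lact a p + q) = a *: f p + f q)).
  by move=> j a p q; rewrite hF qactDl qact_lact.
have FF : forall j p q, qact p (F j q) = 0.
  apply: (FS (fun j f => forall p q, qact p (f q) = 0)).
  by move=> j p q; rewrite hF qact_qact.
have F0 : forall j, F j 0 = 0.
  apply: (FS (fun j f => f 0 = 0)) => j; rewrite hF.
  by apply: (addrI (qact 0 (x j))); rewrite -qactDl !addr0.
have ml j : linear (fun a : subm (elempi_sub A i j) =>
    (val a).1 *: x j + F j (val a).2).
  move=> a u v.
  have e : val (a *: u + v) = a *: val u + val v by rewrite linearP.
  have e1 : (val (a *: u + v)).1 = a * (val u).1 + (val v).1 by rewrite e.
  have e2 : (val (a *: u + v)).2 = dual_lact a (val u).2 + (val v).2 by rewrite e.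
  by rewrite e1 e2 FP scalerDr addrACA scalerDl scalerA.
have mq j q (a : elempi A i j) :
    (mklin (ml (j + 1)) : {linear elempi A i (j + 1) -> X (j + 1)}) (qact q a) =
    qact q ((mklin (ml j) : {linear elempi A i j -> X j}) a).
  rewrite [LHS]/= elempi_qact /= scale0r add0r hF qactA.
  by rewrite qactDr FF addr0.
exists (mkmor mq) => j a a2.
by rewrite /= a2 F0 addr0.
Qed.

(** It suffices to lift the image of the generator: the A-component of an element is a multiple of
    the generator, and the DA-component arises by letting DA act on the generator one degree
    lower. *)
Lemma elempi_projective i : projective (elempi A i).
Proof.
move=> X Y g f gS.
have [x hx] : exists x : forall j, X j, forall j, g j (x j) = f j (elempi_gen i j).
  exists (fun j => sval (cid (gS j (f j (elempi_gen i j))))) => j.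
  by case: (cid _).
have [m hm] := elempi_out i x.
exists m.
have h1 j (a : elempi A i j) : (val a).2 = 0 -> g j (m j a) = f j a.
  move=> a2; rewrite hm // linearZ /= hx -linearZ /=; congr (f j _).
  apply: val_inj; apply: injective_projections; last by rewrite a2; apply: scaler0.
  rewrite -[LHS]/((val a).1 * (if j + 1 == i then 1 else 0)).
  have [ji|/eqP ji] := eqVneq (j + 1) i; first exact: mulr1.
  by rewrite mulr0 (subm_mem a).1.
have h2 j q (a : elempi A i j) : (val a).2 = 0 ->
    g (j + 1) (m (j + 1) (qact q a)) = f (j + 1) (qact q a).
  by move=> a2; rewrite !mor_qact h1.
have h3 : forall j (a : elempi A i j), (val a).1 = 0 -> g j (m j a) = f j a.
  move=> j; rewrite -(subrK 1 j); move: (j - 1) => {}j a a1.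
  have -> : a = qact ((val a).2 : dual A) (elempi_gen i j).
    apply: val_inj; rewrite elempi_qact [LHS]surjective_pairing a1; congr (_, _).
    apply/lfunP => y; rewrite dual_ractE /=.
    have [ji|/eqP ji] := eqVneq (j + 1) i; first by rewrite mul1r.
    by rewrite (subm_mem a).2 // mul0r linear0 zero_lfunE.
  exact: h2.
move=> j a.
have a1P : elempi_sub A i j ((val a).1, 0) by split=> // /(subm_mem a).1.
have a2P : elempi_sub A i j (0, (val a).2) by split=> // /(subm_mem a).2.
have -> : a = (subm_of a1P : elempi A i j) + (subm_of a2P : elempi A i j).
  apply: val_inj; rewrite [LHS]surjective_pairing; congr (_, _) => /=.
    by rewrite addr0.
  by rewrite add0r.
by rewrite /= !linearD /=; congr (_ + _); [apply: h1 | apply: h3].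
Qed.

Lemma kfunctional_smul (V : lmodType A) (psi : V -> k) x :
  kfunctional psi -> exists q : dual A, forall a, q a = psi (a *: x).
Proof.
move=> hp; have hl : linear (fun a : A => psi (a *: x) : k^o).
  by move=> c a b; rewrite scalerDl -mulr_algl -scalerA hp.
exists (linfun (mklin hl)).
by move=> a; rewrite lfunE.
Qed.

(* Morphisms from X to [elempi A i] are the k-functionals on X_i, through the
   value at 1 of the component in DA. *)
Lemma elempi_in i X (psi : forall j, X j -> k) :
  (forall j, kfunctional (psi j)) -> (forall j x, j <> i -> psi j x = 0) ->
  exists m : repmor X (elempi A i), forall j x,
    (forall a, (val (m j x)).2 a = psi j (a *: x)) /\
    (forall q : dual A, q (val (m j x)).1 = psi (j + 1) (qact q x)).
Proof.
move=> hp p0.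
(* The A-component is the element representing, by biduality, the functional that sends q to the
   value of [psi] at [qact q x]. *)
have ex1 j (x : X j) : exists a : A, forall q : dual A, q a = psi (j + 1) (qact q x).
  have [|a ha] := @dual_evaluation _ A (fun q => psi (j + 1) (qact q x)).
    move=> c p q; rewrite qactDl -hp -qact_lact; congr (psi _ (qact _ _ + _)).
    by apply/lfunP => y; rewrite scale_lfunE dual_lactE -scalerAr mulr1 linearZ.
  by exists a => q; rewrite ha.
have [u hu] : exists u : forall j, X j -> A, forall j x (q : dual A),
    q (u j x) = psi (j + 1) (qact q x).
  exists (fun j x => sval (cid (ex1 j x))) => j x.
  by case: (cid _).
have [v hv] : exists v : forall j, X j -> dual A, forall j x a,
    v j x a = psi j (a *: x).
  exists (fun j x => sval (cid (kfunctional_smul x (hp j)))) => j x.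
  by case: (cid _).
have mem j x : elempi_sub A i j (u j x, v j x).
  split=> /= ji; last first.
    by apply/lfunP => a; rewrite hv p0 // zero_lfunE.
  by apply: dual_separates => q; rewrite hu p0 // linear0.
have ml j : linear (fun x : X j => subm_of (mem j x)).
  move=> a x y; apply: val_inj; congr (_, _) => /=.
    apply: dual_separates => q; rewrite linearD /= -dual_ractE !hu qactDr qactA.
    by rewrite kfunctionalD.
  apply/lfunP => b; rewrite add_lfunE [X in _ = X + _]dual_lactE !hv.
  by rewrite scalerDr scalerA kfunctionalD.
have mq j q x : (mklin (ml (j + 1)) : {linear X (j + 1) -> elempi A i (j + 1)}) (qact q x) =
    qact q ((mklin (ml j) : {linear X j -> elempi A i j}) x).
  apply: val_inj; rewrite elempi_qact /=; congr (_, _).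
    by apply: dual_separates => p; rewrite hu qact_qact kfunctional0 // linear0.
  apply/lfunP => a; rewrite hv dual_ractE -qact_lact.
  by rewrite -hu dual_lactE.
exists (mkmor mq) => j x; split=> [a|q] /=; [exact: hv | exact: hu].
Qed.

(** If psi is not zero, the image of its kernel is cut out by functionals on W, one of which does
    not vanish at some [g x0] with psi x0 nonzero. Rescaled, it extends psi, as
    [psi x0 * x - psi x * x0] lies in the kernel. *)
Lemma kfunctional_extend (V W : lmodType A) (g : {linear V -> W}) (psi : V -> k) :
  finitely_generated W -> injective g -> kfunctional psi ->
  exists psi', kfunctional psi' /\ forall x, psi' (g x) = psi x.
Proof.
move=> fgW gI hp.
have [h0|/existsNP [x0 /eqP x0n]] := pselect (forall x, psi x = 0).
  by exists (fun=> 0); split=> [c x y|x]; rewrite ?mulr0 ?addr0 ?h0.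
pose U y := exists2 x, psi x = 0 & g x = y.
have hU : ksubspace U.
  split; first by exists 0; rewrite ?kfunctional0 ?linear0.
  move=> c _ _ [x hx <-] [y hy <-]; exists (c%:A *: x + y).
    by rewrite hp hx hy mulr0 addr0.
  by rewrite linearP.
have [n [phi [hphi phiU]]] := ksubspace_functionals fgW hU.
have : ~ U (g x0) by move=> [x hx /gI e]; move/eqP: x0n; rewrite -e.
move/phiU/existsNP => [l /eqP hl].
exists (fun y => psi x0 / phi l (g x0) * phi l y); split=> [c x y|x].
  by rewrite hphi mulrDr mulrCA.
have : U (g ((psi x0)%:A *: x - (psi x)%:A *: x0)).
  exists ((psi x0)%:A *: x - (psi x)%:A *: x0) => //; rewrite (kfunctionalB hp).
  by rewrite !(kfunctionalZ _ _ hp) mulrC subrr.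
have gZ a y : g (a *: y) = a *: g y by rewrite linearZ.
move/phiU/(_ l); rewrite linearB !gZ (kfunctionalB (hphi l)) !(kfunctionalZ _ _ (hphi l)).
by move/eqP; rewrite subr_eq0 mulrAC => /eqP ->; rewrite mulfK.
Qed.

(** A morphism into [elempi A i] is a functional in degree i, and functionals extend along
    injections. *)
Lemma elempi_injective i : injective_obj (elempi A i).
Proof.
move=> X Y g f gI.
pose psi j (x : X j) := (val (f j x)).2 (1 : A) : k.
have hpsi j : kfunctional (psi j).
  move=> c x y; rewrite /psi linearP /= add_lfunE dual_lactE mul1r.
  by rewrite -[_%:A]mulr1 -scalerAl mul1r linearZ.
have ex1 j : exists phi : Y j -> k, [/\ kfunctional phi,
    forall x, phi (g j x) = psi j x & j <> i -> forall y, phi y = 0].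
  have [ji|/eqP ji] := eqVneq j i.
    have [phi [h1 h2]] := kfunctional_extend (fgmod_fg (Y j)) (gI j) (hpsi j).
    by exists phi.
  exists (fun=> 0); split=> // [c x y|x]; first by rewrite mulr0 addr0.
  by rewrite /psi (subm_mem (f j x)).2 // zero_lfunE.
have [phi hphi] : exists phi : forall j, Y j -> k, forall j, [/\ kfunctional (phi j),
    forall x, phi j (g j x) = psi j x & j <> i -> forall y, phi j y = 0].
  by exists (fun j => sval (cid (ex1 j))) => j; case: (cid _).
have [||m hm] := @elempi_in i Y phi.
- by move=> j; case: (hphi j).
- by move=> j x ji; case: (hphi j) => _ _; apply.
exists m => j x /=.
have psiE j' (z : X j') a : psi j' (a *: z) = (val (f j' z)).2 a.
  by rewrite /psi linearZ /= dual_lactE mul1r.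
apply: val_inj; rewrite [LHS]surjective_pairing [RHS]surjective_pairing; congr (_, _).
  apply: dual_separates => q; rewrite (hm j _).2 -mor_qact.
  case: (hphi (j + 1)) => _ -> _; rewrite -[qact q x]scale1r psiE mor_qact.
  by rewrite elempi_qact dual_ractE mulr1.
apply/lfunP => a; rewrite (hm j _).1 -linearZ /=.
by case: (hphi j) => _ -> _; rewrite psiE.
Qed.

Lemma elempi_projinj i : projinj (elempi A i).
Proof. by split; [apply: elempi_projective | apply: elempi_injective]. Qed.
End Elempi2.

Lemma family_at (I : eqType) (T : I -> Type) (d : forall j, T j) i (t : T i) :
  exists F : forall j, T j, F i = t /\ forall j, j <> i -> F j = d j.
Proof.
exists (dfwith d t); split=> [|j /eqP ji]; first exact: dfwith_in.
by apply: dfwith_out; rewrite eq_sym.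
Qed.

(** * Embeddings into projective-injective modules, and quotients *)

Section Embedding.
Variables (k : fieldType) (A : falgType k).
Implicit Types X Y Z : repmod A.

Section Kernel.
Variables (X : repmod A) (S : subrep X).

(** The sets D that bound such kernels are closed under finite intersections, by direct sums of the
    targets; so a kernel can be cut down to S one functional and one degree at a time. *)
Definition separated_at i (D : X i -> Prop) : Prop :=
  exists (P : repmod A) (m : repmor X P),
    [/\ projinj P, forall j x, S j x -> m j x = 0 & forall x, m i x = 0 -> D x].

Definition separated (D : forall i, X i -> Prop) : Prop :=
  exists (P : repmod A) (m : repmor X P),
    [/\ projinj P, forall j x, S j x -> m j x = 0 & forall i x, m i x = 0 -> D i x].

(** The morphism to [elempi A i] given by psi kills S because S is stable under A and DA; the value
    at 1 of its DA-component recovers psi. *)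
Lemma separated_functional i (psi : X i -> k) :
  kfunctional psi -> (forall x, S i x -> psi x = 0) ->
  separated_at (fun x : X i => psi x = 0).
Proof.
move=> hp hS.
have [F [Fi Fj]] := @family_at _ (fun j => X j -> k) (fun _ _ => 0) i psi.
have F0 j x : j <> i -> F j x = 0 by move=> /Fj ->.
have FS j x : S j x -> F j x = 0.
  by case: (eqVneq j i) x => [->|/eqP ji] x; [rewrite Fi; apply: hS | rewrite F0].
have Fk j : kfunctional (F j).
  case: (eqVneq j i) => [->|/eqP ji]; first by rewrite Fi.
  by move=> c x y; rewrite !F0 // mulr0 addr0.
have [m hm] := elempi_in Fk F0.
exists (elempi A i), m; split; first exact: elempi_projinj.
  move=> j x Sx; apply: val_inj; apply: injective_projections.
    by apply: dual_separates => q; rewrite (hm j x).2 FS ?linear0 //; apply: sr_qact.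
  by apply/lfunP => a; rewrite (hm j x).1 FS ?zero_lfunE //; apply: smZ.
by move=> x mx; rewrite -Fi -[x]scale1r -(hm i x).1 mx zero_lfunE.
Qed.

Lemma separatedT : separated (fun _ _ => True).
Proof.
by exists (elempi A 0), (rep_zero X (elempi A 0)); split=> //; apply: elempi_projinj.
Qed.

Lemma separated_atI i (D D' : X i -> Prop) : separated_at D -> separated_at D' ->
  separated_at (fun x => D x /\ D' x).
Proof.
move=> [P [m [hP hS hD]]] [P' [m' [hP' hS' hD']]].
exists (dsum P P'), (dsum_pair m m'); split; first exact: projinj_dsum.
  by move=> j x Sx /=; rewrite hS // hS'.
by move=> x [/hD ? /hD'].
Qed.

Lemma separatedI (D D' : forall i, X i -> Prop) :
  separated D -> separated D' -> separated (fun i x => D i x /\ D' i x).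
Proof.
move=> [P [m [hP hS hD]]] [P' [m' [hP' hS' hD']]].
exists (dsum P P'), (dsum_pair m m'); split; first exact: projinj_dsum.
  by move=> i x Sx /=; rewrite hS // hS'.
by move=> i x [/hD ? /hD'].
Qed.

Lemma separated_degree i : separated (fun j x => j = i -> S j x).
Proof.
have hS : ksubspace (S i) by split; [exact: sm0 | move=> c x y; apply: smP].
have [n [psi [hp hpS]]] := ksubspace_functionals (fgmod_fg (X i)) hS.
suff /(_ n (leqnn n)) [P [m [hP mS mD]]] : forall r, (r <= n)%N ->
    separated_at (fun x => forall l : 'I_n, (l < r)%N -> psi l x = 0).
  by exists P, m; split=> // j x mx e; subst j; apply/hpS => l; apply: mD.
elim=> [|r IHr] rn.
  by have [P [m [hP mS mD]]] := separatedT; exists P, m.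
have [] := @separated_functional i (psi (Ordinal rn)) (hp _).
  by move=> x /hpS.
move=> P1 [m1 [hP1 mS1 mD1]].
have [P2 [m2 [hP2 mS2 mD2]]] := IHr (ltnW rn).
have [P [m [hP mS mD]]] := separated_atI
  (ex_intro _ P1 (ex_intro _ m1 (And3 hP1 mS1 mD1)))
  (ex_intro _ P2 (ex_intro _ m2 (And3 hP2 mS2 mD2))).
exists P, m; split=> // x /mD [h1 h2] l; rewrite ltnS leq_eqVlt.
case/orP=> [/eqP e|]; last exact: h2.
by rewrite -h1; congr (psi _ x); apply: val_inj.
Qed.

(** Finitely many degrees matter, and in each of them S is the common kernel of finitely many
    functionals. *)
Lemma subrep_kernel : exists (P : repmod A) (m : repmor X P),
  projinj P /\ forall i x, S i x <-> m i x = 0.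
Proof.
have [N hN] := rep_finite X.
suff [P [m [hP mS mD]]] : separated (fun i x => (`|i| <= N)%N -> S i x).
  exists P, m; split=> // i x; split=> [|mx]; first exact: mS.
  case: (leqP `|i|%N N) => [le|lt]; first exact: mD.
  by rewrite (hN i lt x); apply: sm0.
elim: N {hN} => [|n [P1 [m1 [hP1 mS1 mD1]]]].
  have [P [m [hP mS mD]]] := separated_degree 0.
  by exists P, m; split=> // i x mx i0; apply: mD => //; lia.
have [P [m [hP mS mD]]] := separatedI
  (ex_intro _ P1 (ex_intro _ m1 (And3 hP1 mS1 mD1)))
  (separatedI (separated_degree n.+1%:Z) (separated_degree (- n.+1%:Z))).
exists P, m; split=> // i x /mD [h1 [h2 h3]] le.
have [e|[e|e]] : (`|i| <= n)%N \/ i = n.+1%:Z \/ i = - n.+1%:Z by lia.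
- exact: h1.
- exact: h2.
- exact: h3.
Qed.

End Kernel.

Lemma embedding_projinj X : exists (P : repmod A) (m : repmor X P),
  projinj P /\ rep_inj m.
Proof.
have [S hS] := kernel_subrep (rep_id X).
have [P [m [hP hm]]] := subrep_kernel S.
exists P, m; split=> // i x y e; apply/eqP; rewrite -subr_eq0; apply/eqP.
by apply/(hS i); apply/hm; rewrite linearB e subrr.
Qed.

(** An injective object is a retract of any projective-injective module in which it embeds. *)
Lemma injective_projinj X : injective_obj X -> projinj X.
Proof.
move=> iX; have [P [m [hP mI]]] := embedding_projinj X.
have [p hp] := iX _ _ m (rep_id X) mI.
by apply: (projinj_retract (i := m) (p := p)) => // j x; apply: hp.
Qed.

(** The quotient by S is realized as the image of a morphism with kernel S. *)
Lemma quotient_ex X (S : subrep X) : exists (C : repmod A) (p : repmor X C),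
  rep_surj p /\ forall i x, S i x <-> p i x = 0.
Proof.
have [P [m [_ hm]]] := subrep_kernel S.
have [I hI] := image_subrep m.
have [|p hp] := @factor_mono _ _ _ _ _ (subob_in I) m (@subob_in_inj _ _ _ I).
  by move=> i x; apply/subob_inP/hI; exists x.
exists (subob I), p; split=> [i y|i x].
  have /hI [x hx] := (subob_inP I (subob_in I i y)).1 (ex_intro _ y erefl).
  by exists x; apply: (@subob_in_inj _ _ _ I i); rewrite hp.
split=> [/hm mx|px]; last by apply/hm; rewrite -hp px linear0.
by apply: (@subob_in_inj _ _ _ I i); rewrite hp mx linear0.
Qed.

End Embedding.

(** * Fitting's lemma *)

Section Fitting.
Variables (k : fieldType) (A : falgType k).
Implicit Types X Y Z : repmod A.

Section Polynomials.
Variables (X : repmod A) (f : repmor X X).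

Fact rep_scale_linear c i : linear (fun x : X i => c%:A *: x).
Proof.
move=> a x y; rewrite scalerDr !scalerA; congr (_ *: _ + _).
by rewrite -scalerAl -scalerAr mul1r mulr1.
Qed.

Definition rep_scale (c : k) : repmor X X.
Proof.
refine (@mkmor k A X X (fun i => mklin (@rep_scale_linear c i)) _).
move=> i q x; rewrite /= -qactA -qact_lact; congr qact.
apply/lfunP => a; rewrite dual_lactE dual_ractE.
by rewrite -scalerAl -scalerAr mul1r mulr1.
Defined.

Fixpoint peval (s : seq k) : repmor X X :=
  if s is c :: s' then rep_add (rep_scale c) (rep_comp_mor f (peval s'))
  else rep_zero X X.

Lemma pevalC s i x : peval s i (f i x) = f i (peval s i x).
Proof.
elim: s => [|c s IHs] /=; first by rewrite linear0.
by rewrite IHs linearD linearZ.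
Qed.

Lemma peval_kspan i n (w : 'I_n.+1 -> X i) (C : 'M_n.+1) s :
  (forall v, f i (kspan w v) = kspan w (v *m C)) ->
  forall v, peval s i (kspan w v) = kspan w (v *m horner_mx C (Poly s)).
Proof.
move=> hC; elim: s => [|c s IHs] v /=; first by rewrite rmorph0 mulmx0 kspan0.
rewrite IHs hC cons_poly_def rmorphD rmorphM /= horner_mx_X horner_mx_C.
by rewrite mulmxDr [in RHS]addrC mul_mx_scalar kspanP mulmxA.
Qed.

(** Cayley-Hamilton for the matrix of f in degree i. Multiples of p are included so that the
    polynomials of several degrees can be multiplied together. *)
Lemma peval_annihilated i : exists2 p : {poly k}, p != 0 &
  forall r x, peval (r * p) i x = 0.
Proof.
have [n [w hw]] := kspan_ex (fgmod_fg (X i)).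
have [u hu] := choice hw.
pose C := \matrix_j u (f i (w j)).
have hC v : f i (kspan w v) = kspan w (v *m C).
  rewrite kspan_mul {1}/kspan linear_sum; apply: eq_bigr => j _.
  by rewrite linearZ rowK -hu.
exists (char_poly C) => [|r x]; first exact/monic_neq0/char_poly_monic.
rewrite (hu x) (peval_kspan _ hC) polyseqK rmorphM /= Cayley_Hamilton.
by rewrite mulr0 mulmx0 kspan0.
Qed.

Lemma peval_zero : exists2 p : {poly k}, p != 0 & forall i x, peval p i x = 0.
Proof.
have [n hn] := rep_finite X.
suff [p p0 hp] : exists2 p : {poly k}, p != 0 &
    forall r i x, (`|i| <= n)%N -> peval (r * p) i x = 0.
  exists p => // i x; rewrite -[p]mul1r.
  case: (leqP `|i|%N n) => [le|lt]; first exact: hp.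
  by rewrite (hn i lt x) linear0.
elim: n {hn} => [|n [p p0 hp]].
  have [p p0 hp] := peval_annihilated 0.
  exists p => // r i x i0; have e : i = 0 by lia.
  subst i.
  exact: hp.
have [p1 p10 hp1] := peval_annihilated n.+1%:Z.
have [p2 p20 hp2] := peval_annihilated (- n.+1%:Z).
exists (p * p1 * p2) => [|r i x le]; first by rewrite !mulf_neq0.
have [e|[e|e]] : (`|i| <= n)%N \/ i = n.+1%:Z \/ i = - n.+1%:Z by lia.
- by rewrite mulrC -!mulrA mulrC; apply: hp.
- by subst i; rewrite [p * p1]mulrC -mulrA mulrC -mulrA mulrC; apply: hp1.
- by subst i; rewrite mulrA; apply: hp2.
Qed.

Fixpoint rpow n : repmor X X :=
  if n is n'.+1 then rep_comp_mor f (rpow n') else rep_id X.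

Lemma rpowSr n i x : rpow n.+1 i x = rpow n i (f i x).
Proof. by elim: n => //= n ->. Qed.

Lemma rpowD m n i x : rpow (m + n) i x = rpow m i (rpow n i x).
Proof. by elim: m => //= m ->. Qed.

(** Split off the lowest nonzero coefficient c of an annihilating polynomial: from
    [f^m (c + f s(f)) = 0] follows [f^m = f^(m+1) g] with [g = - c^-1 s(f)]. *)
Lemma rpow_factor : exists n (g : repmor X X),
  (forall i x, g i (f i x) = f i (g i x)) /\
  forall i x, rpow n i x = rpow n.+1 i (g i x).
Proof.
have [p p0 hp] := peval_zero.
suff: forall (s : seq k) m, has (fun c => c != 0) s ->
    (forall i x, rpow m i (peval s i x) = 0) ->
    exists n (g : repmor X X), (forall i x, g i (f i x) = f i (g i x)) /\
      forall i x, rpow n i x = rpow n.+1 i (g i x).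
  move/(_ p 0%N); apply; last exact: hp.
  apply/hasP; exists (lead_coef p); rewrite ?lead_coef_eq0 // lead_coefE.
  by rewrite mem_nth // prednK // size_poly_gt0.
elim=> [//|c s IHs] m /=; have [-> /= hs h|c0 _ h] := eqVneq c 0.
  apply: (IHs m.+1 hs) => i x; rewrite -[RHS](h i x) rpowSr /=.
  by rewrite !scale0r add0r.
exists m, (rep_comp_mor (rep_scale (- c^-1)) (peval s)); split=> [i x|i x].
  by rewrite /= pevalC linearZ.
apply/eqP; rewrite -subr_eq0; apply/eqP.
rewrite -[RHS](h i (c^-1%:A *: x)) linearD; congr (_ + _).
  by rewrite scalerA -scalerAl mul1r scalerA mulfV // !scale1r.
transitivity (- rpow m.+1 i (rep_scale (- c^-1) i (peval s i x))) => //.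
rewrite rpowSr -linearN; congr (rpow m i _); rewrite -linearN; congr (f i _).
have -> : rep_scale (- c^-1) i (peval s i x) = - (c^-1%:A *: peval s i x).
  by rewrite /= !scaleNr.
by rewrite opprK linearZ.
Qed.

Lemma rpowC (g : repmor X X) n : (forall i x, g i (f i x) = f i (g i x)) ->
  forall i x, g i (rpow n i x) = rpow n i (g i x).
Proof. by move=> h i x; elim: n => //= n <-; rewrite h. Qed.
End Polynomials.

(** With F and G the powers n + 1 of f and of the g of [rpow_factor], F and G commute and
    [F = F F G], so [e = F G] is the idempotent onto the image of F. *)
Lemma fitting X (f : repmor X X) : exists n (e h : repmor X X),
  [/\ forall i x, e i (e i x) = e i x,
      forall i x, e i x = rpow f n.+1 i (h i x),
      forall i x, e i x = h i (rpow f n.+1 i x) &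
      forall i x, rpow f n.+1 i (e i x) = rpow f n.+1 i x].
Proof.
have [n [g [gC hg]]] := rpow_factor f.
have hg1 i x : rpow f n.+1 i x = rpow f n.+2 i (g i x).
  by rewrite {1}/rpow -/(rpow f n) /= hg.
have fgC := rpowC n.+1 gC.
have hgm m i x : rpow f n.+1 i x = rpow f n.+1 i (rpow f m i (rpow g m i x)).
  elim: m => // m IHm; rewrite IHm -!rpowD addnC [in RHS]addnC !rpowD.
  by rewrite [rpow f n.+1 i (rpow g m i x)]hg1 [RHS]rpowSr.
have FGC i x : rpow g n.+1 i (rpow f n.+1 i x) = rpow f n.+1 i (rpow g n.+1 i x).
  by elim: {1 4}n.+1 x => //= m IHm x; rewrite IHm fgC.
have [F FE] : exists F, F = rpow f n.+1 by exists (rpow f n.+1).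
have [G GE] : exists G, G = rpow g n.+1 by exists (rpow g n.+1).
have hF i x : F i x = F i (F i (G i x)) by rewrite FE GE; apply: hgm.
rewrite -FE -GE in FGC.
exists n, (rep_comp_mor F G), G; rewrite -FE; split=> i x //=.
- by rewrite FGC -hF.
- by rewrite -FGC.
- by rewrite -hF.
Qed.

Lemma split_idempotent X (e : repmor X X) : (forall i x, e i (e i x) = e i x) ->
  exists (Y Z : repmod A) (i1 : repmor Y X) (i2 : repmor Z X)
    (p1 : repmor X Y) (p2 : repmor X Z),
  [/\ @is_biproduct (repA A) X Y Z,
      forall j y, p1 j (i1 j y) = y,
      forall j z, p2 j (i2 j z) = z,
      forall j x, i1 j (p1 j x) = e j x &
      forall j x, i2 j (p2 j x) = x - e j x].
Proof.
move=> ee.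
have [S hS] := image_subrep e; have [T hT] := kernel_subrep e.
have SI := @subob_in_inj _ _ _ S; have TI := @subob_in_inj _ _ _ T.
have [|p1 hp1] := @factor_mono _ _ _ _ _ (subob_in S) e SI.
  by move=> i x; apply/subob_inP/hS; exists x.
have Ne i x : e i (x - e i x) = 0 by rewrite linearB ee subrr.
pose e' : repmor X X := rep_add (rep_id X) (rep_comp_mor (rep_scale X (-1)) e).
have e'E i x : e' i x = x - e i x by rewrite /= !scaleN1r.
have [|p2 hp2] := @factor_mono _ _ _ _ _ (subob_in T) e' TI.
  by move=> i x; apply/subob_inP/hT; rewrite e'E.
have eS j y : e j (subob_in S j y) = subob_in S j y.
  have /hS [x <-] := (subob_inP S (subob_in S j y)).1 (ex_intro _ y erefl).
  exact: ee.
have eT j z : e j (subob_in T j z) = 0.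
  by apply/hT/subob_inP; exists z.
have h1 j y : p1 j (subob_in S j y) = y by apply: SI; rewrite hp1 eS.
have h2 j z : p2 j (subob_in T j z) = z by apply: TI; rewrite hp2 e'E eT subr0.
exists (subob S), (subob T), (subob_in S), (subob_in T), p1, p2.
split=> // [|j x]; last by rewrite hp2 e'E.
exists (subob_in S), (subob_in T), p1, p2; split=> // j x.
- by apply: SI; rewrite [LHS]hp1 eT linear0.
- by apply: TI; rewrite [LHS]hp2 e'E eS subrr linear0.
- rewrite -[LHS]/(subob_in S j (p1 j x) + subob_in T j (p2 j x)).
  by rewrite hp1 hp2 e'E addrC subrK.
Qed.

(** F is a bare family of functions, so that sums and differences of morphisms can be written
    pointwise. *)
Definition stably_zero X Y (F : forall i, X i -> Y i) : Prop :=
  exists (P : repmod A) (u : repmor X P) (v : repmor P Y),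
    [/\ projective P, injective_obj P & forall i x, F i x = v i (u i x)].

Lemma nilpotent_bij X (f : repmor X X) n : (forall i x, rpow f n i x = 0) ->
  exists g : repmor X X,
    (forall i x, g i (x + f i x) = x) /\ forall i x, g i x + f i (g i x) = x.
Proof.
move=> fn; pose f' : repmor X X := rep_comp_mor (rep_scale X (-1)) f.
have f'E i x : f' i x = - f i x by rewrite /= !scaleN1r.
suff [g [hg1 hg2]] : exists g : repmor X X,
    (forall i x, g i (f i x) = f i (g i x)) /\ forall i x, g i x + f i (g i x) = x.
  by exists g; split=> // i x; rewrite linearD hg1 hg2.
(* [geo m] is the partial sum of the first m terms of the geometric series of - f. *)
pose fix geo m : repmor X X :=
  if m is m'.+1 then rep_add (rep_id X) (rep_comp_mor f' (geo m')) else rep_zero X X.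
have geoC m i x : geo m i (f i x) = f i (geo m i x).
  elim: m => [|m IHm]; first by rewrite /= linear0.
  rewrite -[LHS]/(f i x + f' i (geo m i (f i x))).
  by rewrite -[RHS]/(f i (x + f' i (geo m i x))) IHm !f'E linearD linearN.
exists (geo n); split; first exact: geoC.
have geoE m i x : geo m i x + f i (geo m i x) = x - rpow f' m i x.
  elim: m => [|m IHm]; first by rewrite /= linear0 addr0 subrr.
  rewrite -[rpow f' m.+1 i x]/(f' i (rpow f' m i x)) f'E opprK.
  rewrite -[geo m.+1 i x]/(x + f' i (geo m i x)) f'E linearB -linearN.
  rewrite -addrA; congr (_ + _).
  have -> : rpow f' m i x = x - (geo m i x + f i (geo m i x)).
    by rewrite IHm opprB addrC subrK.
  by rewrite linearB linearD linearN opprD addrCA.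
have f'n m i x : rpow f' m i x = (-1) ^+ m *: rpow f m i x.
  elim: m => [|m IHm]; first by rewrite expr0 scale1r.
  rewrite -[LHS]/(f' i (rpow f' m i x)) f'E IHm linearZ /= exprS mulN1r scaleNr.
  by [].
by move=> i x; rewrite geoE f'n fn scaler0 subr0.
Qed.

(** Fitting decomposition: f is invertible on Y and nilpotent on Z. *)
Lemma split_nilpotent X (f : repmor X X) :
  exists n (Y : repmod A) (i1 : repmor Y X) (p1 : repmor X Y) (Z : repmod A)
    (h : repmor X X),
  [/\ @is_biproduct (repA A) X Y Z,
      forall j y, p1 j (i1 j y) = y,
      forall j x, i1 j (p1 j x) = h j (rpow f n.+1 j x) /\
        i1 j (p1 j x) = rpow f n.+1 j (h j x),
      (forall j (y : Y j), y = 0) -> forall j x, rpow f n.+1 j x = 0 &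
      (forall j (z : Z j), z = 0) -> forall j x, i1 j (p1 j x) = x].
Proof.
have [n [e [h [ee eF eF' Fe]]]] := fitting f.
have [Y [Z [i1 [i2 [p1 [p2 [bi h1 h2 h3 h4]]]]]]] := split_idempotent ee.
exists n, Y, i1, p1, Z, h; split=> // [j x|Y0 j x|Z0 j x].
- by rewrite {1}h3 eF' h3 eF.
- by rewrite -Fe -h3 (Y0 j (p1 j x)) !linear0.
- by apply/eqP; rewrite h3 eq_sym -subr_eq0 -h4 (Z0 j (p2 j x)) linear0.
Qed.

Lemma biproductC X Y Z : @is_biproduct (repA A) X Y Z -> @is_biproduct (repA A) X Z Y.
Proof.
move=> [i1 [i2 [p1 [p2 [h1 h2 h3 h4 h5]]]]].
by exists i2, i1, p2, p1; split=> // i x; rewrite -[RHS](h5 i x); apply: addrC.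
Qed.

(** The Fitting summand on which [v u] is invertible is a retract of P, hence projective, hence
    zero. *)
Lemma projective_factor_nilpotent X P (u : repmor X P) (v : repmor P X) :
  no_projective_summand X -> projective P ->
  exists n, forall i x, rpow (rep_comp_mor v u) n i x = 0.
Proof.
move=> npX pP; set f := rep_comp_mor v u.
have [n [Y [i1 [p1 [Z [h [bi h1 h2 h4 _]]]]]]] := split_nilpotent f.
exists n.+1; apply: h4; apply: (npX _ _ bi).
have retr j y : rep_comp_mor p1 (rep_comp_mor h (rep_comp_mor (rpow f n) v)) j
    (rep_comp_mor u i1 j y) = y.
  by rewrite -[RHS]h1 -[in RHS](h1 j y) (h2 _ _).1 rpowSr.
exact: projective_retract retr pP.
Qed.

Lemma projective_factor_bij X (F : forall i, X i -> X i) :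
  no_projective_summand X -> stably_zero F -> exists g : repmor X X,
    (forall i x, g i (x + F i x) = x) /\ forall i x, g i x + F i (g i x) = x.
Proof.
move=> npX [P [u [v [pP _ hF]]]].
have [n hn] := projective_factor_nilpotent u v npX pP.
have [g [g1 g2]] := nilpotent_bij hn.
by exists g; split=> i x; rewrite hF; [apply: g1 | apply: g2].
Qed.

Lemma stable_eq_ext X Y (f g : repmor X Y) : (forall i x, f i x = g i x) ->
  stable_eq f g.
Proof.
move=> fg; exists (elempi A 0), (rep_zero _ _), (rep_zero _ _).
have [pE iE] := elempi_projinj A 0.
by split=> // i x; rewrite fg subrr.
Qed.

Lemma stable_zero_projective X : @is_zero (stabA A) X -> projective X.
Proof.
move=> [P [u [v [pP _ h]]]].
by apply: (projective_retract (i := u) (p := v)) => // j x; rewrite -h /= subr0.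
Qed.

Lemma stable_biproduct X Y Z :
  @is_biproduct (repA A) X Y Z -> @is_biproduct (stabA A) X Y Z.
Proof.
move=> [i1 [i2 [p1 [p2 [h1 h2 h3 h4 h5]]]]].
by exists i1, i2, p1, p2; split; apply: stable_eq_ext.
Qed.

(** One of the two Fitting summands is stably zero, that is projective, and so zero since X has no
    projective summand. *)
Lemma indecomposable_local X (f : repmor X X) :
  @indecomposable (stabA A) X -> no_projective_summand X ->
  (exists n, forall i x, rpow f n i x = 0) \/
  exists g : repmor X X, (forall i x, g i (f i x) = x) /\ forall i x, f i (g i x) = x.
Proof.
move=> [_ iX] npX.
have [n [Y [i1 [p1 [Z [h [bi h1 h2 h4 h5]]]]]]] := split_nilpotent f.
have [/stable_zero_projective/(npX _ _ bi) Y0|] := iX _ _ (stable_biproduct bi).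
  by left; exists n.+1; apply: h4.
move=> /stable_zero_projective/(npX _ _ (biproductC bi)) Z0; right.
have fR i x : f i (rpow f n i (h i x)) = x by rewrite -[RHS]h5 // (h2 _ _).2.
have fL i x : h i (rpow f n i (f i x)) = x by rewrite -rpowSr -(h2 _ _).1 h5.
exists (rep_comp_mor (rpow f n) h); split=> i x; last exact: fR.
by rewrite -[LHS]fL fR fL.
Qed.
End Fitting.

(** * The stable category and its triangles *)

Section Stable.
Variables (k : fieldType) (A : falgType k).
Implicit Types X Y Z W : repmod A.

Definition rep_opp X Y (f : repmor X Y) : repmor X Y :=
  rep_comp_mor (rep_scale Y (-1)) f.

Lemma rep_oppE X Y (f : repmor X Y) i x : rep_opp f i x = - f i x.
Proof. by rewrite /= !scaleN1r. Qed.

Definition rep_sub X Y (f g : repmor X Y) : repmor X Y := rep_add f (rep_opp g).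

Lemma rep_subE X Y (f g : repmor X Y) i x : rep_sub f g i x = f i x - g i x.
Proof. by rewrite -rep_oppE. Qed.

Lemma sz_ext X Y (F G : forall i, X i -> Y i) :
  (forall i x, F i x = G i x) -> stably_zero F -> stably_zero G.
Proof.
by move=> FG [P [u [v [pP iP h]]]]; exists P, u, v; split=> // i x; rewrite -FG.
Qed.

Lemma sz_projinj X Y P (u : repmor X P) (v : repmor P Y) : projinj P ->
  stably_zero (fun i x => v i (u i x)).
Proof. by move=> [pP iP]; exists P, u, v. Qed.

Lemma sz0 X Y (F : forall i, X i -> Y i) : (forall i x, F i x = 0) -> stably_zero F.
Proof.
move=> F0; apply: (sz_ext (F := fun i x => rep_zero (elempi A 0) Y i (rep_zero _ _ i x))).
  by move=> i x; rewrite F0.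
exact/sz_projinj/elempi_projinj.
Qed.

Lemma szB X Y (F G : forall i, X i -> Y i) : stably_zero F -> stably_zero G ->
  stably_zero (fun i x => F i x - G i x).
Proof.
move=> [P [u [v [pP iP h]]]] [P' [u' [v' [pP' iP' h']]]].
apply: (sz_ext (F := fun i x => dsum_case v (rep_opp v') i (dsum_pair u u' i x))).
  by move=> i x; rewrite h h' -rep_oppE.
by apply: sz_projinj; apply: projinj_dsum.
Qed.

Lemma szN X Y (F : forall i, X i -> Y i) : stably_zero F ->
  stably_zero (fun i x => - F i x).
Proof.
move=> hF; apply: sz_ext (szB (sz0 (F := fun i (x : X i) => 0 : Y i) _) hF) => //.
by move=> i x; rewrite sub0r.
Qed.

Lemma szD X Y (F G : forall i, X i -> Y i) : stably_zero F -> stably_zero G ->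
  stably_zero (fun i x => F i x + G i x).
Proof.
move=> hF hG; apply: sz_ext (szB hF (szN hG)) => i x.
by rewrite opprK.
Qed.

Lemma sz_compl X Y Z (F : forall i, X i -> Y i) (g : repmor Y Z) :
  stably_zero F -> stably_zero (fun i x => g i (F i x)).
Proof.
move=> [P [u [v [pP iP h]]]]; exists P, u, (rep_comp_mor g v).
by split=> // i x; rewrite h.
Qed.

Lemma sz_compr X Y Z (F : forall i, Y i -> Z i) (g : repmor X Y) :
  stably_zero F -> stably_zero (fun i x => F i (g i x)).
Proof.
move=> [P [u [v [pP iP h]]]]; exists P, (rep_comp_mor u g), v.
by split=> // i x; rewrite h.
Qed.

(** * Pushouts and standard triangles *)

Section Pushout.
Variables (X Y I Z : repmod A) (i : repmor X I) (f : repmor X Y).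
Variables (j : repmor I Z) (g : repmor Y Z).
Hypothesis po : @is_pushout (repA A) _ _ _ _ i f j g.

Lemma pushout_comm l x : j l (i l x) = g l (f l x).
Proof. by case: po => + _; apply. Qed.

(** A morphism [m] whose kernel is the image of (g, j) agrees with zero on Y and on I, so uniqueness
    in the universal property makes it zero. *)
Lemma pushout_surj : rep_surj (dsum_case g j).
Proof.
have [S hS] := image_subrep (dsum_case g j).
have [P [m [_ hm]]] := subrep_kernel S.
have [_ /(_ P (rep_comp_mor m j) (rep_comp_mor m g))] := po.
case=> [l x|c [_ cU]]; first by rewrite /= pushout_comm.
move=> l z; apply/hS/hm.
have m0 : forall l z, m l z = c l z by apply: cU.
have c0 : forall l z, rep_zero Z P l z = c l z.
  apply: cU => l' x' /=; apply/esym/hm/hS.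
    by exists (0, x'); rewrite /= linear0 add0r.
  by exists (x', 0); rewrite /= linear0 addr0.
by rewrite m0 -c0.
Qed.

(** Let [m] have the image of (f, -i) as its kernel. Its restrictions to Y and I agree on X, so it
    factors through the pushout and kills (y, x). *)
Lemma pushout_kernel l y x : g l y + j l x = 0 ->
  exists x0, y = f l x0 /\ x = - i l x0.
Proof.
move=> e; have [S hS] := image_subrep (dsum_pair f (rep_opp i)).
have [P [m [_ hm]]] := subrep_kernel S.
pose inl := dsum_pair (rep_id Y) (rep_zero Y I).
pose inr := dsum_pair (rep_zero I Y) (rep_id I).
have [_ /(_ P (rep_comp_mor m inr) (rep_comp_mor m inl))] := po.
case=> [l' x'|c [[cj cg] _]].
  rewrite /=; apply/eqP; rewrite eq_sym -subr_eq0 -linearB; apply/eqP/hm/hS.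
  exists x'; apply: injective_projections => /=; first by rewrite subr0.
  by rewrite !scaleN1r sub0r.
have : m l (y, x) = 0.
  have -> : (y, x) = inl l y + inr l x.
    by apply: injective_projections; rewrite /= ?addr0 ?add0r.
  rewrite linearD.
  have /= <- := cg l y; have /= <- := cj l x.
  by rewrite -linearD e linear0.
move/hm/hS => [x0 [e1 e2]]; exists x0; split=> //.
by rewrite -e2 !scaleN1r.
Qed.
End Pushout.

Section StandardTriangle.
Variables (T : translation A) (X Y Z : repmod A).
Variables (f : repmor X Y) (g : repmor Y Z) (h : repmor Z (cosyz (T X))).
Hypothesis std : standard_triangle f g h.

Lemma hull_projinj : projinj (hull_ob (T X)).
Proof. by apply: injective_projinj; case: (hull_inP (T X)). Qed.

Lemma standard_zero : stably_zero (fun i x => g i (f i x)).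
Proof.
have [j [po _ _]] := std.
apply: sz_ext (sz_projinj (hull_in (T X)) j hull_projinj) => i x.
exact: pushout_comm po _ _.
Qed.

(** The factorization of [u f] through the injective Q extends from X to its hull, and the pushout
    then yields w. *)
Lemma standard_weak_cokernel W (u : repmor Y W) :
  stably_zero (fun i x => u i (f i x)) ->
  exists w : repmor Z W, forall i y, w i (g i y) = u i y.
Proof.
have [j [[_ po] _ _]] := std => -[Q [a [b [_ iQ hu]]]].
have [_ hI _] := hull_inP (T X).
have [a' ha] := iQ _ _ _ a hI.
have [|c [[_ cg] _]] := po W (rep_comp_mor b a') u.
  by move=> i x; rewrite /= hu; congr (b i _); apply: ha.
by exists c.
Qed.

(** Write [g u = b a] through the projective Q and lift b to (b1, b2) along the surjection from the
    sum of Y and the hull. Then (u - b1 a, - b2 a) lies in the kernel of that surjection, hence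
    comes from X. *)
Lemma standard_weak_kernel N (u : repmor N Y) :
  stably_zero (fun i x => g i (u i x)) ->
  exists t : repmor N X, stably_zero (fun i x => u i x - f i (t i x)).
Proof.
have [j [po _ _]] := std => -[Q [a [b [pQ iQ hu]]]].
have [_ hI _] := hull_inP (T X).
have [b' hb] := pQ _ _ _ b (pushout_surj po).
pose b1 := rep_comp_mor (dsum_fst _ _) b'; pose b2 := rep_comp_mor (dsum_snd _ _) b'.
have hb' i x : g i (b1 i x) + j i (b2 i x) = b i x by apply: hb.
have [||t ht] := @factor_mono _ _ _ _ _ (dsum_pair f (rep_opp (hull_in (T X))))
    (dsum_pair (rep_sub u (rep_comp_mor b1 a)) (rep_opp (rep_comp_mor b2 a))).
- by move=> i x y [_]; rewrite !scaleN1r => /oppr_inj/hI.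
- move=> i z.
  have [|x [e1 e2]] := @pushout_kernel _ _ _ _ _ _ _ _ po i
    (rep_sub u (rep_comp_mor b1 a) i z) (rep_opp (rep_comp_mor b2 a) i z).
    rewrite rep_subE rep_oppE !linearB linearN /= hu -hb' /=.
    by rewrite -addrA -opprD subrr.
  exists x; apply: injective_projections; first exact: esym e1.
  exact: etrans (rep_oppE _ _) (esym e2).
- exists t; apply: sz_ext (sz_projinj a b1 (conj pQ iQ)) => i x.
  have /(congr1 fst) e := ht i x.
  rewrite -[f i _]/((dsum_pair f (rep_opp (hull_in (T X))) i (t i x)).1) e.
  by rewrite -[(_, _).1]/(rep_sub u (rep_comp_mor b1 a) i x) rep_subE opprB addrC subrK.
Qed.
End StandardTriangle.
End Stable.

(** * Stable equality and distinguished triangles *)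

Section StableEq.
Variables (k : fieldType) (A : falgType k).
Implicit Types X Y Z W N : repmod A.

Definition steq X Y (F G : forall i, X i -> Y i) : Prop :=
  stably_zero (fun i x => F i x - G i x).

Lemma steq_trans X Y (F G H : forall i, X i -> Y i) :
  steq F G -> steq G H -> steq F H.
Proof.
move=> h1 h2; apply: sz_ext (szD h1 h2) => i x.
by rewrite addrA subrK.
Qed.

Lemma steq_sym X Y (F G : forall i, X i -> Y i) : steq F G -> steq G F.
Proof. by move=> h; apply: sz_ext (szN h) => i x; rewrite opprB. Qed.

Lemma steq_compl X Y Z (g : repmor Y Z) (F G : forall i, X i -> Y i) :
  steq F G -> steq (fun i x => g i (F i x)) (fun i x => g i (G i x)).
Proof. by move=> h; apply: sz_ext (sz_compl g h) => i x; rewrite linearB. Qed.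

Lemma steq_compr X Y Z (g : repmor X Y) (F G : forall i, Y i -> Z i) :
  steq F G -> steq (fun i x => F i (g i x)) (fun i x => G i (g i x)).
Proof. by move=> h; apply: sz_ext (sz_compr g h). Qed.

Lemma steq_sz X Y (F G : forall i, X i -> Y i) : steq F G ->
  stably_zero G -> stably_zero F.
Proof.
by move=> h h0; apply: sz_ext (szD h h0) => i x; rewrite subrK.
Qed.

Section Distinguished.
Variables (T : translation A) (X Y Z : repmod A).
Variables (f : repmor X Y) (g : repmor Y Z) (h : repmor Z (cosyz (T X))).
Hypothesis dt : distinguished f g h.

(** This and the next two lemmas hold for the standard triangle and are carried over by the stable
    isomorphisms [a], [b], [c]. *)
Lemma triangle_zero : stably_zero (fun i x => g i (f i x)).
Proof.
have [X' [Y' [Z' [f' [g' [h' [a [b [c [w]]]]]]]]]] := dt.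
move=> [std [[a' [a'a aa']] [b' [b'b bb']] [c' [c'c cc']]] _ [bf cg _]].
apply: (steq_sz (steq_sym (steq_compr f (steq_compr g c'c)))).
apply: (steq_sz (steq_compl c' (steq_compr f cg))).
apply: (steq_sz (steq_compl c' (steq_compl g' bf))).
exact: (sz_compl c' (sz_compr a (standard_zero std))).
Qed.

Lemma triangle_weak_cokernel W (u : repmor Y W) :
  stably_zero (fun i x => u i (f i x)) ->
  exists w : repmor Z W, steq (fun i y => u i y) (fun i y => w i (g i y)).
Proof.
have [X' [Y' [Z' [f' [g' [h' [a [b [c [w]]]]]]]]]] := dt.
move=> [std [[a' [a'a aa']] [b' [b'b bb']] [c' [c'c cc']]] _ [bf cg _]] uf.
have [|v hv] := @standard_weak_cokernel _ _ _ _ _ _ _ _ _ std W (rep_comp_mor u b').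
  apply: (steq_sz (steq_sym (steq_compl u (steq_compl b' (steq_compl f' aa'))))).
  apply: (steq_sz (steq_sym (steq_compl u (steq_compl b' (steq_compr a' bf))))).
  apply: (steq_sz (steq_compl u (steq_compr a' (steq_compr f b'b)))).
  exact: (sz_compr a' uf).
exists (rep_comp_mor v c).
apply: (steq_trans _ (steq_sym (steq_compl v cg))).
apply: (steq_trans (steq_sym (steq_compl u b'b))).
by apply: sz0 => i x; rewrite /= hv subrr.
Qed.

Lemma triangle_weak_kernel N (u : repmor N Y) :
  stably_zero (fun i x => g i (u i x)) ->
  exists t : repmor N X, steq (fun i y => u i y) (fun i y => f i (t i y)).
Proof.
have [X' [Y' [Z' [f' [g' [h' [a [b [c [w]]]]]]]]]] := dt.
move=> [std [[a' [a'a aa']] [b' [b'b bb']] [c' [c'c cc']]] _ [bf cg _]] gu.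
have [|t ht] := @standard_weak_kernel _ _ _ _ _ _ _ _ _ std N (rep_comp_mor b u).
  exact: (steq_sz (steq_sym (steq_compr u cg)) (sz_compl c gu)).
exists (rep_comp_mor a' t).
apply: (steq_trans (steq_sym (steq_compr u b'b))).
apply: (steq_trans (steq_compl b' ht)).
apply: (steq_trans (steq_sym (steq_compl b' (steq_compl f' (steq_compr t aa'))))).
apply: (steq_trans (steq_sym (steq_compl b' (steq_compr t (steq_compr a' bf))))).
exact: (steq_compr t (steq_compr a' (steq_compr f b'b))).
Qed.
End Distinguished.
End StableEq.

(** * Irreducible morphisms *)

Lemma factor_surj (R : pzRingType) (V W U : lmodType R)
    (p : {linear V -> W}) (e : {linear V -> U}) :
  (forall w, exists v, p v = w) -> (forall v, p v = 0 -> e v = 0) ->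
  exists e' : {linear W -> U}, forall v, e' (p v) = e v.
Proof.
move=> pS pe; have [s hs] := choice pS.
have eE x y : p x = p y -> e x = e y.
  move=> h; apply/eqP; rewrite -subr_eq0 -linearB; apply/eqP/pe.
  by rewrite linearB h subrr.
have hl : linear (fun w => e (s w)).
  by move=> a x y /=; rewrite -linearP; apply: eE; rewrite linearP !hs.
by exists (mklin hl) => v; apply: eE; rewrite hs.
Qed.

Lemma factor_inj (R : pzRingType) (V W U : lmodType R)
    (m : {linear V -> W}) (e : {linear U -> W}) :
  injective m -> (forall u, exists v, m v = e u) ->
  exists e' : {linear U -> V}, forall u, m (e' u) = e u.
Proof.
move=> mI me; have [s hs] := choice me.
have hl : linear s by move=> a x y; apply: mI; rewrite linearP !hs linearP.
by exists (mklin hl).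
Qed.

Section Irreducible.
Variables (k : fieldType) (A : falgType k).
Implicit Types X Y Z W N : repmod A.

(** [g f] differs from the identity by a morphism through a projective, so it is invertible. *)
Lemma stable_split_mono X Y (f : repmor X Y) : no_projective_summand X ->
  @split_mono (stabA A) _ _ f -> @split_mono (repA A) _ _ f.
Proof.
move=> npX [g hg].
have [p [p1 _]] := projective_factor_bij npX hg.
exists (rep_comp_mor p g) => i x.
by rewrite -[RHS]p1 /= addrC subrK.
Qed.

Lemma stable_split_epi X Y (f : repmor X Y) : no_projective_summand Y ->
  @split_epi (stabA A) _ _ f -> @split_epi (repA A) _ _ f.
Proof.
move=> npY [g hg].
have [p [_ p2]] := projective_factor_bij npY hg.
exists (rep_comp_mor g p) => i x.
by rewrite -[RHS]p2 /= addrC subrK.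
Qed.

Lemma split_mono_stable X Y (f : repmor X Y) :
  @split_mono (repA A) _ _ f -> @split_mono (stabA A) _ _ f.
Proof. by move=> [g hg]; exists g; apply: stable_eq_ext. Qed.

Lemma split_epi_stable X Y (f : repmor X Y) :
  @split_epi (repA A) _ _ f -> @split_epi (stabA A) _ _ f.
Proof. by move=> [g hg]; exists g; apply: stable_eq_ext. Qed.

Lemma stable_irreducible X Y (f : repmor X Y) :
  no_projective_summand X -> no_projective_summand Y ->
  @irreducible (stabA A) _ _ f -> @irreducible (repA A) _ _ f.
Proof.
move=> npX npY [nsm nse fact]; split.
- by move/split_mono_stable.
- by move/split_epi_stable.
- move=> Z u v fvu; have [|/(stable_split_mono npX)|/(stable_split_epi npY)] := fact Z u v.
  + exact: stable_eq_ext.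
  + by left.
  + by right.
Qed.

(** If f factors through a projective-injective, irreducibility makes the identity of X or of Y
    stably zero, and then the zero morphism splits f. *)
Lemma irreducible_nonzero X Y (f : repmor X Y) :
  @irreducible (stabA A) _ _ f -> ~ stably_zero (fun i x => f i x).
Proof.
move=> [nsm nse fact] [P [u [v [pP iP fvu]]]].
have [|[g hg]|[g hg]] := fact P u v.
- exact: stable_eq_ext.
- apply: nsm; exists (rep_zero Y X).
  have := szN (steq_sz (steq_sym hg) (sz_projinj u g (conj pP iP))).
  by apply: sz_ext => i x; rewrite sub0r.
- apply: nse; exists (rep_zero Y X).
  have := szN (steq_sz (steq_sym hg) (sz_projinj g v (conj pP iP))).
  by apply: sz_ext => i x; rewrite [X in _ = X - _]linear0 sub0r.
Qed.

(** f is stably [f p^n] for all n, so a nilpotent p would make f stably zero; by locality p is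
    invertible. *)
Lemma stable_absorb X Y (f : repmor X Y) (p : repmor X X) :
  @irreducible (stabA A) _ _ f -> @indecomposable (stabA A) X ->
  no_projective_summand X -> steq (fun i x => f i x) (fun i x => f i (p i x)) ->
  exists g : repmor X X, (forall i x, g i (p i x) = x) /\ forall i x, p i (g i x) = x.
Proof.
move=> irr iX npX hp; have [[n pn]|//] := indecomposable_local p iX npX.
case: (irreducible_nonzero irr).
have : stably_zero (fun i x => f i (rpow p n i x)).
  by apply: sz0 => i x; rewrite pn linear0.
apply: steq_sz; elim: n {pn} => [|n IHn]; first by apply: sz0 => i x; rewrite subrr.
apply: (steq_trans hp); apply: (steq_trans (steq_compr p IHn)).
by apply: sz0 => i x; rewrite rpowSr subrr.
Qed.

Lemma stable_absorbl X Y (f : repmor X Y) (p : repmor Y Y) :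
  @irreducible (stabA A) _ _ f -> @indecomposable (stabA A) Y ->
  no_projective_summand Y -> steq (fun i x => f i x) (fun i x => p i (f i x)) ->
  exists g : repmor Y Y, (forall i x, g i (p i x) = x) /\ forall i x, p i (g i x) = x.
Proof.
move=> irr iY npY hp; have [[n pn]|//] := indecomposable_local p iY npY.
case: (irreducible_nonzero irr).
have : stably_zero (fun i x => rpow p n i (f i x)).
  by apply: sz0 => i x; rewrite pn.
apply: steq_sz; elim: n {pn} => [|n IHn]; first by apply: sz0 => i x; rewrite subrr.
exact: (steq_trans hp (steq_compl p IHn)).
Qed.
Lemma irreducible_not_bij X Y (g : repmor X Y) :
  @irreducible (stabA A) _ _ g -> rep_inj g -> ~ rep_surj g.
Proof.
move=> [nsm _ _] gI gS; apply: nsm; apply: split_mono_stable.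
have [|s hs] := @factor_mono _ _ _ _ _ g (rep_id Y) gI.
  by move=> i z; have [y <-] := gS i z; exists y.
by exists s => i y; apply: gI; apply: hs.
Qed.
End Irreducible.


(** * The trichotomy for irreducible morphisms *)

Section Trichotomy.
Variables (k : fieldType) (A : falgType k).

Section Factor.
Variables (X Y : repmod A) (h : repmor X Y).

(* [fr] and [fc] are meant to invert [fu] and [fv] in the degrees where these
   are isomorphisms; elsewhere they are irrelevant. *)
Record degree_factor (i : int) := DegreeFactor {
  fW : fgmod A;
  fu : {linear X i -> fW};
  fv : {linear fW -> Y i};
  fr : {linear fW -> X i};
  fc : {linear Y i -> fW};
  fvu : forall x, fv (fu x) = h i x }.

Definition factor_l i : degree_factor i :=
  @DegreeFactor i (X i) idfun (h i) idfun \0 (fun=> erefl).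
Definition factor_r i : degree_factor i :=
  @DegreeFactor i (Y i) (h i) idfun \0 idfun (fun=> erefl).

Variables (j : int) (F : forall i, degree_factor i).
Hypothesis Fl : forall i, i < j ->
  (forall x, fr (F i) (fu (F i) x) = x) /\ forall w, fu (F i) (fr (F i) w) = w.
Hypothesis Fr : forall i, j < i ->
  (forall y, fv (F i) (fc (F i) y) = y) /\ forall w, fc (F i) (fv (F i) w) = w.

(** Below j the action is computed in X, from j on in Y. The module in degree j only receives from X
    and maps to Y, so it can be arbitrary. *)
Definition glue_act i (q : dual A) (w : fW (F i)) : fW (F (i + 1)) :=
  if i < j then fu (F (i + 1)) (qact q (fr (F i) w))
  else fc (F (i + 1)) (qact q (fv (F i) w)).

Lemma glue_actl i q (w : fW (F i)) : i < j ->
  glue_act q w = fu (F (i + 1)) (qact q (fr (F i) w)).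
Proof. by rewrite /glue_act => ->. Qed.

Lemma glue_actr i q (w : fW (F i)) : j <= i ->
  glue_act q w = fc (F (i + 1)) (qact q (fv (F i) w)).
Proof. by rewrite /glue_act ltNge => ->. Qed.

Fact glue_qaction : qaction (fun i => fW (F i)).
Proof.
exists glue_act.
- move=> i; case: (ltP i j) => ij; split=> [p q m|p m n|p a m];
    rewrite ?(glue_actl _ _ ij) ?(glue_actr _ _ ij).
  + by rewrite qactDl linearD.
  + by rewrite linearD qactDr linearD.
  + by rewrite qactA linearZ.
  + by rewrite qactDl linearD.
  + by rewrite linearD qactDr linearD.
  + by rewrite qactA linearZ.
- move=> i a q x; case: (ltP i j) => ij; rewrite ?(glue_actl _ _ ij) ?(glue_actr _ _ ij).
    by rewrite qact_lact linearZ.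
  by rewrite qact_lact linearZ.
- move=> i p q x; case: (ltP i j) => ij.
    rewrite (glue_actl _ _ ij); case: (ltP (i + 1) j) => ij1.
      by rewrite (glue_actl _ _ ij1) (Fl ij1).1 qact_qact linear0.
    by rewrite (glue_actr _ _ ij1) fvu -mor_qact qact_qact !linear0.
  have ji1 : j < i + 1 by lia.
  rewrite (glue_actr _ _ ij) (glue_actr _ _ (ltW ji1)) (Fr ji1).1.
  by rewrite qact_qact linear0.
- have [m hm] := rep_finite X; have [n hn] := rep_finite Y.
  exists (m + n + `|j|)%N => i hi w.
  have [ij|ji] : i < j \/ j < i by lia.
    have im : (m < `|i|)%N by lia.
    by rewrite -[w](Fl ij).2 (hm i im (fr (F i) w)) linear0.
  have im : (n < `|i|)%N by lia.
  by rewrite -[w](Fr ji).2 (hn i im (fv (F i) w)) linear0.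
Defined.

Definition glue : repmod A := mkrep glue_qaction.

Lemma glue_factor : exists (U : repmor X glue) (V : repmor glue Y),
  [/\ forall i x, h i x = V i (U i x),
      forall i x, U i x = fu (F i) x & forall i w, V i w = fv (F i) w].
Proof.
have hU i q x : (fu (F (i + 1)) : {linear X (i + 1) -> glue (i + 1)}) (qact q x) =
    qact q ((fu (F i) : {linear X i -> glue i}) x).
  rewrite mkrep_qact -[RHS]/(glue_act q (fu (F i) x)).
  case: (ltP i j) => ij; first by rewrite (glue_actl _ _ ij) (Fl ij).1.
  have ji1 : j < i + 1 by lia.
  by rewrite (glue_actr _ _ ij) fvu -mor_qact -(fvu (F (i + 1))) (Fr ji1).2.
have hV i q w : (fv (F (i + 1)) : {linear glue (i + 1) -> Y (i + 1)}) (qact q w) =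
    qact q ((fv (F i) : {linear glue i -> Y i}) w).
  rewrite mkrep_qact -[X in fv _ X]/(glue_act q w).
  case: (ltP i j) => ij.
    by rewrite (glue_actl _ _ ij) fvu mor_qact -(fvu (F i)) (Fl ij).2.
  have ji1 : j < i + 1 by lia.
  by rewrite (glue_actr _ _ ij) (Fr ji1).1.
exists (mkmor hU), (mkmor hV); split=> // i x.
by rewrite -(fvu (F i)).
Qed.
End Factor.

Variables (X Y : repmod A) (h : repmor X Y).

(** Above j the component of U is that of h, and below j so is that of V; a splitting of U or V thus
    splits h in those degrees. *)
Lemma factor_degree j (W : fgmod A) (u : {linear X j -> W}) (v : {linear W -> Y j}) :
  (forall x, h j x = v (u x)) ->
  exists (Z : repmod A) (U : repmor X Z) (V : repmor Z Y),
  [/\ forall i x, h i x = V i (U i x),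
      @split_mono (repA A) _ _ U -> @split_mono (modA A) _ _ u /\
        forall i, j < i -> @split_mono (modA A) _ _ (h i) &
      @split_epi (repA A) _ _ V -> @split_epi (modA A) _ _ v /\
        forall i, i < j -> @split_epi (modA A) _ _ (h i)].
Proof.
move=> hvu.
pose t := @DegreeFactor _ _ h j W u v \0 \0 (fun x => esym (hvu x)).
have [F [Fj Fd]] := family_at (fun i => if i < j then factor_l h i else factor_r h i) t.
have Fdl i : i < j -> F i = factor_l h i.
  by move=> ij; rewrite Fd ?ij //; lia.
have Fdr i : j < i -> F i = factor_r h i.
  by move=> ji; rewrite Fd; [rewrite ltNge ltW | lia].
have Fl i : i < j ->
  (forall x, fr (F i) (fu (F i) x) = x) /\ forall w, fu (F i) (fr (F i) w) = w.
  by move=> /Fdl ->.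
have Fr i : j < i ->
  (forall y, fv (F i) (fc (F i) y) = y) /\ forall w, fc (F i) (fv (F i) w) = w.
  by move=> /Fdr ->.
have [U [V [hUV hU hV]]] := glue_factor Fl Fr.
exists (glue Fl Fr), U, V; split=> // [[G hG]|[G hG]].
  have hF i : exists r : {linear fW (F i) -> X i}, forall x, r (fu (F i) x) = x.
    by exists (G i) => x; rewrite -hU; apply: hG.
  split=> [|i ji].
    by have := hF j; rewrite Fj => -[r hr]; exists r.
  by have := hF i; rewrite (Fdr _ ji) => -[r hr]; exists r.
have hF i : exists r : {linear Y i -> fW (F i)}, forall x, fv (F i) (r x) = x.
  by exists (G i) => x; rewrite -hV; apply: hG.
split=> [|i ij].
  by have := hF j; rewrite Fj => -[r hr]; exists r.
by have := hF i; rewrite (Fdl _ ij) => -[r hr]; exists r.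
Qed.

Lemma bijective_split i : injective (h i) -> (forall y, exists x, h i x = y) ->
  @split_mono (modA A) _ _ (h i) /\ @split_epi (modA A) _ _ (h i).
Proof.
move=> hI hS.
have [r hr] := @factor_inj _ _ _ _ (h i) idfun hI hS.
split; exists r => x; last exact: hr.
by apply: hI; apply: hr.
Qed.

Lemma irreducible_inj_surj : @irreducible (repA A) _ _ h -> rep_inj h \/ rep_surj h.
Proof.
move=> [_ _ fact].
have [S hS] := image_subrep h.
have [|p hp] := @factor_mono _ _ _ _ _ (subob_in S) h (@subob_in_inj _ _ _ S).
  by move=> i x; apply/subob_inP/hS; exists x.
have [|[r hr]|[r hr]] := fact _ p (subob_in S).
- by move=> i x; rewrite -hp.
- left=> i x y; rewrite -!hp => /(@subob_in_inj _ _ _ S i) e.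
  by rewrite -[x](hr i) -[y](hr i) /= e.
- right=> i y; have /hS [x hx] := (subob_inP S y).1 (ex_intro _ (r i y) (hr i y)).
  by exists x.
Qed.

Lemma irreducible_trichotomy :
  @irreducible (repA A) _ _ h -> [\/ smonic h, sepic h | sirreducible h].
Proof.
move=> irr; have [_ _ fact] := irr.
case: (pselect (smonic h)) => [|nm]; first by constructor 1.
case: (pselect (sepic h)) => [|ne]; first by constructor 2.
constructor 3; split=> //.
(* Use the target itself in degree j: U does not split, since h does not in degree j, so V does. *)
have cut j : ~ @split_mono (modA A) _ _ (h j) ->
    forall i, i < j -> @split_epi (modA A) _ _ (h i).
  move=> nj; have [Z [U [V [UV hU hV]]]] := @factor_degree j (Y j) (h j) idfun (fun=> erefl).
  by have [//|/hU [/nj]|/hV []] := fact Z U V.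
have [a na] : exists a, ~ @split_mono (modA A) _ _ (h a) by apply/existsNP.
have [b nb] : exists b, ~ @split_epi (modA A) _ _ (h b) by apply/existsNP.
(* If [a] and [b] both fail, h is split epi at [a] and split mono at [b]; as h is injective or
   surjective, it is bijective at one of them, which is absurd. *)
have [i0 [m0 e0]] : exists i0, ~ @split_mono (modA A) _ _ (h i0) /\
    ~ @split_epi (modA A) _ _ (h i0).
  case: (pselect (@split_epi (modA A) _ _ (h a))) => [[r hr]|?]; last by exists a.
  case: (pselect (@split_mono (modA A) _ _ (h b))) => [[s hs]|?]; last by exists b.
  have [hI|hS] := irreducible_inj_surj irr.
    by case: na; apply: (bijective_split (hI a) _).1 => y; exists (r y); apply: hr.
  by case: nb; apply: (bijective_split (can_inj (g := s) hs) (hS b)).2.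
exists i0; split=> // [i mi ei|].
  by case: (ltgtP i i0) => // [/(cut _ m0)|/(cut _ mi)].
split=> // W u v hvu; have [Z [U [V [UV hU hV]]]] := factor_degree hvu.
by have [//|/hU []|/hV []] := fact Z U V; [left|right].
Qed.
End Trichotomy.

(** * Auslander-Reiten triangles *)

Section Aux.
Variables (k : fieldType) (A : falgType k).

Lemma projinj_subobject_zero (N Z : repmod A) (nu : repmor N Z) :
  no_projective_summand Z -> rep_inj nu -> projinj N -> forall i (n : N i), n = 0.
Proof.
move=> npZ nuI [pN iN] i n.
have [s hs] := iN _ _ _ (rep_id N) nuI.
have sK j x : s j (nu j x) = x by apply: hs.
have [|Y' [Z' [i1 [i2 [p1 [p2 [bi h1 _ h3 _]]]]]]] :=
    @split_idempotent _ _ Z (rep_comp_mor nu s).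
  by move=> j x; rewrite /= sK.
have pY : projective Y'.
  apply: (projective_retract (i := rep_comp_mor s i1) (p := rep_comp_mor p1 nu)) => // j x.
  have /= e := h3 j (i1 j x).
  by rewrite /= -e !h1.
have Y0 := npZ _ _ bi pY.
rewrite -[n]sK -[nu i n]/(nu i n) -{1}[n]sK -[nu i (s i _)]h3.
by rewrite (Y0 i (p1 i _) : p1 i _ = 0) !linear0.
Qed.

(** Take one copy of [elempi A (i0 + 1)], which lives in degrees i0 and i0 + 1, for each generator
    of X in degree i0. *)
Lemma generating_projinj i0 (X : repmod A) : exists (P : repmod A) (c : repmor P X),
  [/\ projinj P, forall i, i0 + 1 < i -> forall p : P i, p = 0 &
      forall x : X i0, exists p, c i0 p = x].
Proof.
have [n [s hs]] := fgmod_fg (X i0).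
suff /(_ n (leqnn n)) [P [c [hP P0 Pc]]] : forall r, (r <= n)%N ->
    exists (P : repmod A) (c : repmor P X),
    [/\ projinj P, forall i, i0 + 1 < i -> forall p : P i, p = 0 &
      forall l : 'I_n, (l < r)%N -> exists p, c i0 p = s l].
  exists P, c; split=> // x; have [a ->] := hs x.
  have [p hp] := choice (fun l => Pc l (ltn_ord l)).
  exists (\sum_l a l *: p l); rewrite linear_sum; apply: eq_bigr => l _.
  by rewrite linearZ hp.
have E0 i : i0 + 1 < i -> forall p : elempi A (i0 + 1) i, p = 0.
  move=> lt p; apply: val_inj; have [h1 h2] := subm_mem p.
  by apply: injective_projections; [apply: h1 | apply: h2]; lia.
elim=> [|r IHr] rn.
  exists (elempi A (i0 + 1)), (rep_zero _ _); split=> //; exact: elempi_projinj.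
have [P [c [hP P0 Pc]]] := IHr (ltnW rn).
have [x [xi _]] := @family_at _ (fun j => X j) (fun=> 0) i0 (s (Ordinal rn)).
have [m hm] := elempi_out (i0 + 1) x.
exists (dsum P (elempi A (i0 + 1))), (dsum_case c m); split.
- by apply: projinj_dsum => //; apply: elempi_projinj.
- by move=> i lt [p q]; congr (_, _); [apply: P0 | apply: E0].
- move=> l; rewrite ltnS leq_eqVlt => /orP [/eqP lr|lr].
    exists (0, elempi_gen A (i0 + 1) i0); rewrite /= linear0 add0r hm //=.
    rewrite eqxx scale1r xi; congr s; exact/val_inj/esym.
  have [p hp] := Pc l lr.
  by exists (p, 0); rewrite /= linear0 addr0.
Qed.

Definition generated (X : repmod A) i0 (C : X i0 -> Prop) i (x : X i) : Prop :=
  forall S : subrep X, (forall c, C c -> S i0 c) -> S i x.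

Lemma generated_subrep (X : repmod A) i0 (C : X i0 -> Prop) :
  exists S : subrep X, forall i x, S i x <-> generated C x.
Proof.
apply: (@mk_subrep _ _ X (fun i x => @generated X i0 C i x)).
- by move=> i S _; apply: sm0.
- by move=> i a x y hx hy S SC; apply: smP; [apply: hx | apply: hy].
- by move=> i q x hx S SC; apply: sr_qact; apply: hx.
Qed.
End Aux.

Lemma int_min (Q : int -> Prop) (n : nat) :
  (exists i, Q i) -> (forall i, Q i -> - n%:Z <= i) ->
  exists i, Q i /\ forall i' : int, i' < i -> ~ Q i'.
Proof.
move=> [i0 Qi0] Qn.
have ex : exists m, `[< Q (m%:Z - n%:Z) >].
  exists (absz (i0 + n%:Z)); apply/asboolP.
  have := Qn _ Qi0 => ?; have -> : (absz (i0 + n%:Z))%:Z - n%:Z = i0 by lia.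
  by [].
case: (ex_minnP ex) => m /asboolP Qm mmin; exists (m%:Z - n%:Z); split=> // i' lt Qi'.
have le := Qn _ Qi'.
have : (m <= absz (i' + n%:Z)%R)%N.
  by apply: mmin; apply/asboolP; have -> : (absz (i' + n%:Z))%:Z - n%:Z = i' by lia.
lia.
Qed.


Section ARTriangle.
Variables (k : fieldType) (A : falgType k) (X Y Z : repmod A).
Variables (f : repmor X Y) (g : repmor Y Z).
Hypotheses (npX : no_projective_summand X) (npY : no_projective_summand Y).
Hypotheses (npZ : no_projective_summand Z).
Hypotheses (iX : @indecomposable (stabA A) X) (iZ : @indecomposable (stabA A) Z).
Hypothesis irr : @irreducible (stabA A) _ _ f.
Hypothesis gf0 : stably_zero (fun i x => g i (f i x)).
Hypothesis wk : forall N (u : repmor N Y), stably_zero (fun i x => g i (u i x)) ->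
  exists t : repmor N X, steq (fun i x => u i x) (fun i x => f i (t i x)).
Hypothesis wc : forall W (u : repmor Y W), stably_zero (fun i x => u i (f i x)) ->
  exists w : repmor Z W, steq (fun i x => u i x) (fun i x => w i (g i x)).
Hypothesis ras : forall N (u : repmor N Z), ~ @split_epi (stabA A) _ _ u ->
  exists v : repmor N Y, steq (fun i x => u i x) (fun i x => g i (v i x)).

Lemma weak_kernel_nilpotent (t : repmor Y X) :
  exists n, forall i x, rpow (rep_comp_mor t f) n i x = 0.
Proof.
have [//|[p [p1 _]]] := indecomposable_local (rep_comp_mor t f) iX npX.
by have [[]] := irr; exists (rep_comp_mor p t); apply: stable_eq_ext.
Qed.

Lemma AR_irreducible : @irreducible (stabA A) _ _ g.
Proof.
have fN := irreducible_nonzero irr; split=> [[s hs]|[s hs]|W u v guv].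
- apply: fN; apply: (steq_sz (steq_sym (steq_compr f hs))).
  exact: (sz_compl s gf0).
(* If s is a stable section of g, then 1 - s g is stably f t, whence f is stably f t f; so t f is
   invertible and f splits. *)
- have [|t ht] := @wk _ (rep_sub (rep_id Y) (rep_comp_mor s g)).
    apply: sz_ext (steq_sym (steq_compr g hs)) => i x.
    by rewrite rep_subE linearB.
  have hp : steq (fun i x => f i x) (fun i x => f i (rep_comp_mor t f i x)).
    apply: steq_trans (steq_compr f ht).
    by apply: sz_ext (sz_compl s gf0) => i x; rewrite rep_subE subKr.
  have [p [p1 _]] := stable_absorb irr iX npX hp.
  by have [[]] := irr; exists (rep_comp_mor p t); apply: stable_eq_ext.
- case: (pselect (@split_epi (stabA A) _ _ v)) => [?|nv]; [by right|left].
  (* As v is not a split epi it is stably g w, so g kills 1 - w u, which is stably f t. *)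
  have [w hw] := ras nv.
  have [|t ht] := @wk _ (rep_sub (rep_id Y) (rep_comp_mor w u)).
    apply: sz_ext (steq_trans guv (steq_compr u hw)) => i x.
    by rewrite rep_subE linearB.
  have [n hn] := weak_kernel_nilpotent t.
  (* Powers of f t pass through powers of the nilpotent t f, so 1 - f t, which is stably w u, is
     invertible. *)
  pose ft := rep_opp (rep_comp_mor f t).
  have ftn m i x : rpow ft m.+1 i x =
        (-1) ^+ m.+1 *: f i (rpow (rep_comp_mor t f) m i (t i x)).
    elim: m => [|m IHm].
      by rewrite -[LHS]/(ft i x) rep_oppE expr1 scaleN1r.
    rewrite -[LHS]/(ft i (rpow ft m.+1 i x)) rep_oppE IHm.
    by rewrite [in RHS]exprS mulN1r scaleNr /= -!linearZ.
  have [i x|p [p1 _]] := @nilpotent_bij _ _ _ ft n.+1.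
    by rewrite ftn hn linear0 scaler0.
  have wu : steq (fun i x => w i (u i x)) (fun i x => x - f i (t i x)).
    apply: sz_ext (szN ht) => i x; rewrite rep_subE /=.
    by rewrite !opprB addrCA.
  exists (rep_comp_mor p w); apply: (steq_trans (steq_compl p wu)).
  by apply: sz0 => i x; rewrite -rep_oppE [p i _]p1 subrr.
Qed.

Lemma smonic_inj (V W : repmod A) (u : repmor V W) : smonic u -> rep_inj u.
Proof. by move=> su i; have [r hr] := su i; exact: (can_inj (g := r) hr). Qed.

Lemma sepic_surj (V W : repmod A) (u : repmor V W) : sepic u -> rep_surj u.
Proof. by move=> su i y; have [r hr] := su i; exists (r y); apply: hr. Qed.

Lemma smonic_sepic : smonic f -> sepic g.
Proof.
move=> sf; have fI := smonic_inj sf.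
have [S hS] := image_subrep f.
have [C [p [pS pker]]] := quotient_ex S.
have pf i x : p i (f i x) = 0 by apply/pker/hS; exists x.
have [|d hd] := @wc _ p; first exact: sz0.
have [P [u [v [pP iP hgf]]]] := gf0.
(* The factor u of g f extends to Y because f is injective; then g - v u' kills the image of f and
   factors through p. *)
have [u' hu'] := iP _ _ f u fI.
have [|c hc] := @factor_epi _ _ _ _ _ p (rep_sub g (rep_comp_mor v u')) pS.
  move=> i x /pker/hS [y <-]; rewrite rep_subE /= hgf.
  by apply/eqP; rewrite subr_eq0; apply/eqP; congr (v i _); rewrite -[LHS](hu' i y).
have cpg : steq (fun i x => c i (p i x)) (fun i x => g i x).
  apply: sz_ext (szN (sz_projinj u' v (conj pP iP))) => i x.
  by rewrite hc rep_subE /= addrC addKr.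
(* Since c d fixes the irreducible g stably and Z is indecomposable, c d is invertible. *)
have gcd : steq (fun i x => g i x) (fun i x => rep_comp_mor c d i (g i x)).
  exact: (steq_trans (steq_sym cpg) (steq_compl c hd)).
have [e [_ he]] := stable_absorbl AR_irreducible iZ npZ gcd.
have cpS : rep_surj (rep_comp_mor c p).
  by move=> i z; have [x hx] := pS i (d i (e i z)); exists x; rewrite /= hx; apply: he.
(* With v = c p v', g becomes c p after the automorphism 1 + v' u' of Y. *)
have [v' hv'] := pP _ _ _ v cpS.
have [q [_ q2]] := projective_factor_bij npY (sz_projinj u' v' (conj pP iP)).
have gE i y : g i y = c i (p i (y + v' i (u' i y))).
  rewrite !linearD /=; have /= -> := hv' i (u' i y).
  by rewrite hc rep_subE /= subrK.
move=> i; have [r hr] := sf i.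
(* For a retraction r of f in degree i, 1 - f r kills the image of f and so induces a section of
   p. *)
have pe y : p i y = 0 -> (idfun \- (f i \o r))%R y = 0.
  by move=> /pker/hS [x <-] /=; have /= -> := hr x; rewrite subrr.
have [s hs] := @factor_surj _ _ _ _ (p i) (idfun \- (f i \o r)) (pS i) pe.
have ps w : p i (s w) = w.
  by have [y <-] := pS i w; rewrite hs /= linearB pf subr0.
exists (q i \o (s \o (d i \o e i)) : {linear Z i -> Y i}) => z /=.
by rewrite gE q2 ps; apply: he.
Qed.

(** Dual to [smonic_sepic], with the kernel [m] of g in place of the cokernel of f. *)
Lemma sepic_smonic : sepic g -> smonic f.
Proof.
move=> sg; have gS := sepic_surj sg.
have [S hS] := kernel_subrep g.
pose K := subob S; pose m : repmor K Y := subob_in S.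
have mI : rep_inj m := @subob_in_inj _ _ _ S.
have gm i x : g i (m i x) = 0 by apply/hS/subob_inP; exists x.
have [|t ht] := @wk _ m; first exact: sz0.
have [P [u [v [pP iP hgf]]]] := gf0.
have [v' hv'] := pP _ _ g v gS.
have [|d hd] := @factor_mono _ _ _ _ _ m (rep_sub f (rep_comp_mor v' u)) mI.
  move=> i x; apply/subob_inP/hS; rewrite rep_subE linearB hgf /=.
  by have /= -> := hv' i (u i x); rewrite subrr.
have ftd : steq (fun i x => f i x) (fun i x => f i (rep_comp_mor t d i x)).
  apply: steq_trans (steq_compr d ht).
  apply: sz_ext (sz_projinj u v' (conj pP iP)) => i x.
  by rewrite hd rep_subE subKr.
have [e [he _]] := stable_absorb irr iX npX ftd.
have mdI : rep_inj (rep_comp_mor m d).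
  move=> i x y /mI dxy; rewrite -[x]he -[y]he /=.
  by congr (e i (t i _)).
have [u' hu'] := iP _ _ _ u mdI.
have [q [q1 _]] := projective_factor_bij npY (sz_projinj u' v' (conj pP iP)).
have fE i x : f i x = m i (d i x) + v' i (u' i (m i (d i x))).
  by rewrite [u' i _]hu' hd rep_subE subrK.
move=> i; have [s hs] := sg i.
have me y : exists x, m i x = (idfun \- (s \o g i))%R y.
  apply/subob_inP/hS; rewrite /= linearB; have /= -> := hs (g i y).
  by rewrite subrr.
have [r hr] := @factor_inj _ _ _ _ (m i) (idfun \- (s \o g i)) (mI i) me.
have rm w : r (m i w) = w.
  by apply: mI; rewrite hr /= gm linear0 subr0.
exists ((e i \o t i) \o (r \o q i) : {linear Y i -> X i}) => z /=.
by rewrite fE q1 rm; apply: he.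
Qed.
Lemma sepic_not_smonic : sepic f -> ~ smonic g.
Proof.
have girr := AR_irreducible; move=> sf sg; have gI := smonic_inj sg.
have [r rg] : exists r : forall i, {linear Z i -> Y i}, forall i y, r i (g i y) = y.
  by exists (fun i => sval (cid (sg i))) => i y; case: (cid _) => s hs /=; apply: hs.
(* A degree where r has a kernel is one where g is not onto. One exists because g is injective but
   not bijective, and a least one because Z is bounded below. *)
have [i0 [[c0 [rc0 c0n]] i0min]] : exists i0, (exists z : Z i0, r i0 z = 0 /\ z <> 0) /\
    forall i, i < i0 -> ~ (exists z : Z i, r i z = 0 /\ z <> 0).
  have [n hn] := rep_finite Z; apply: (@int_min _ n).
    apply: contrapT => /forallNP h; apply: (irreducible_not_bij girr gI) => i z.
    exists (r i z); apply/eqP; rewrite eq_sym -subr_eq0; apply/eqP.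
    apply: contrapT => zn; apply: (h i); exists (z - g i (r i z)).
    by rewrite linearB rg subrr.
  move=> i [z [_ zn]]; case: (leP (- n%:Z) i) => // lt; case: zn; apply: (hn i _ z).
  lia.
have gS i : i < i0 -> forall z, exists y, g i y = z.
  move=> lt z; exists (r i z); apply/eqP; rewrite eq_sym -subr_eq0; apply/eqP.
  apply: contrapT => zn; apply: (i0min i lt); exists (z - g i (r i z)).
  by rewrite linearB rg subrr.
pose C (z : Z i0) := r i0 z = 0.
have [N hN] := generated_subrep C.
have NC z : C z -> N i0 z by move=> Cz; apply/hN => S; apply.
(* B is an upper bound for N: N vanishes outside degrees i0 and i0 + 1, and lies in C in degree
   i0. *)
have [B hB] : exists B : subrep Z, forall i z, B i z <->
    [/\ i < i0 -> z = 0, i = i0 -> r i z = 0, i0 < i -> forall q, qact q z = 0 &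
        i0 + 1 < i -> z = 0].
  apply: (@mk_subrep _ _ Z (fun i z => [/\ i < i0 -> z = 0, i = i0 -> r i z = 0,
    i0 < i -> forall q, qact q z = 0 & i0 + 1 < i -> z = 0])).
  - by move=> i; split=> // [_|_ q]; rewrite ?linear0 // qact0r.
  - move=> i a x y [x1 x2 x3 x4] [y1 y2 y3 y4]; split=> [h|h|h q|h].
    + by rewrite x1 // y1 // scaler0 addr0.
    + by rewrite linearP x2 // y2 // scaler0 addr0.
    + by rewrite qactDr -qactA x3 // y3 // addr0.
    + by rewrite x4 // y4 // scaler0 addr0.
  - move=> i q x [x1 x2 x3 x4]; split=> [h|h|h p|h].
    + by rewrite x1 ?qact0r //; lia.
    + by rewrite x1 ?qact0r ?linear0 //; lia.
    + exact: qact_qact.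
    + by rewrite x3 //; lia.
have NB i z : N i z -> B i z.
  move=> /hN; apply=> c Cc; apply/hB; split=> //; lia.
have Nr z : N i0 z -> r i0 z = 0 by move=> /NB/hB [_ + _ _]; apply.
pose nu := subob_in N; have nuI : rep_inj nu := @subob_in_inj _ _ _ N.
have nuN i n : N i (nu i n) by apply/subob_inP; exists n.
case: (pselect (forall i z, N i z)) => [NZ|Nproper].
  have Y0 i (y : Y i) : i <> i0 + 1 -> y = 0.
    move=> ii; apply: gI; rewrite linear0.
    have /NB/hB [z1 z2 _ z4] := NZ i (g i y).
    case: (ltgtP i i0) => lt; first exact: z1.
      by apply: z4; lia.
    by rewrite -[y]rg z2 // linear0.
  have [P [ga [[pP iP] P0 gaC]]] := generating_projinj i0 Z.
  have [I hI] := image_subrep ga.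
  have gaS : rep_surj ga.
    move=> i z; apply/hI; apply: ((hN i z).1 (NZ i z)) => c _.
    by apply/hI; apply: gaC.
  (* S is the pullback of g and [ga], inside P. Its map h to Y satisfies g h = ga m, through P, so h
     is stably f t. *)
  have [S hS] : exists S : subrep P, forall i p, S i p <-> exists y, g i y = ga i p.
    apply: (@mk_subrep _ _ P (fun i p => exists y, g i y = ga i p)).
    - by move=> i; exists 0; rewrite !linear0.
    - by move=> i a p q [x hx] [y hy]; exists (a *: x + y); rewrite !linearP hx hy.
    - by move=> i q p [x hx]; exists (qact q x); rewrite !mor_qact hx.
  pose m := subob_in S; have mI : rep_inj m := @subob_in_inj _ _ _ S.
  have [|h hh] := @factor_mono _ _ _ _ _ g (rep_comp_mor ga m) gI.
    by move=> i p; apply/hS/subob_inP; exists p.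
  have [|t ht] := @wk _ h.
    by apply: sz_ext (sz_projinj m ga (conj pP iP)) => i p; rewrite hh.
  (* Lifting g f along [ga] gives a morphism from X into S and f = h t'; thus t t' is invertible and
     X embeds in P. *)
  have [Q [u [v [pQ iQ hgf]]]] := gf0.
  have [v' hv'] := pQ _ _ _ v gaS.
  have gav i x : ga i (v' i (u i x)) = g i (f i x).
    by rewrite hgf; apply: hv'.
  have [|t' ht'] := @factor_mono _ _ _ _ _ m (rep_comp_mor v' u) mI.
    by move=> i x; apply/subob_inP/hS; exists (f i x); rewrite /= gav.
  have hf i x : f i x = h i (t' i x).
    by apply: gI; rewrite hh -gav; congr (ga i _); rewrite -[RHS]/(m i (t' i x)) ht'.
  have ftt : steq (fun i x => f i x) (fun i x => f i (rep_comp_mor t t' i x)).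
    apply: steq_trans (steq_compr t' ht).
    by apply: sz0 => i x; rewrite hf subrr.
  have [e [he _]] := stable_absorb irr iX npX ftt.
  have X0 i (x : X i) : i0 + 1 < i -> x = 0.
    move=> lt; rewrite -[x]he -[X in e i X]/(t i (t' i x)).
    have -> : t' i x = 0 by apply: mI; rewrite ht' linear0; apply: P0.
    by rewrite !linear0.
  have [s hs] : exists s : forall i, {linear Y i -> X i}, forall i y, f i (s i y) = y.
    by exists (fun i => sval (cid (sf i))) => i y; case: (cid _) => s' hs' /=; apply: hs'.
  (* Y lives in degree i0 + 1 and X vanishes in degree i0 + 2, so the componentwise sections commute
     with DA. *)
  have sq i q y : s (i + 1) (qact q y) = qact q (s i y).
    have [ii|/eqP ii] := eqVneq i (i0 + 1).
      by rewrite [LHS]X0 ?[RHS]X0 //; lia.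
    by rewrite (Y0 i y ii) qact0r !linear0 qact0r.
  by case: irr => _ nse _; apply/nse/split_epi_stable; exists (mkmor sq); apply: hs.
have nse : ~ @split_epi (stabA A) _ _ nu.
  move/(stable_split_epi npZ) => [s hs]; apply: Nproper => i z.
  by apply/subob_inP; exists (s i z); apply: hs.
have [v [P [ep [de [pP iP hnu]]]]] := ras nse.
have [I hI] := image_subrep g.
have [D [rho [rhoS rhoK]]] := quotient_ex I.
have rg0 i y : rho i (g i y) = 0 by apply/rhoK/hI; exists y.
have [W hW] : exists W : subrep Z, forall i z, W i z <-> (i <= i0 -> z = 0).
  apply: (@mk_subrep _ _ Z (fun i z => i <= i0 -> z = 0)) => //.
    by move=> i a x y hx hy le; rewrite hx // hy // scaler0 addr0.
  by move=> i q x hx le; rewrite hx ?qact0r //; lia.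
pose om := subob_in W.
have omW i w : W i (om i w) by apply/subob_inP; exists w.
(* The cokernel D of g vanishes below i0, is covered by C in degree i0, and by W above it. *)
have cS : rep_surj (dsum_case (rep_comp_mor rho nu) (rep_comp_mor rho om)).
  move=> i d; have [z <-] := rhoS i d.
  case: (ltgtP i i0) => ii0.
  - by have [y <-] := gS i ii0 z; exists 0; rewrite rg0 linear0.
  - have /subob_inP [w hw] : W i z by apply/hW => le; lia.
    by exists (0, w); rewrite -hw /= !linear0 add0r.
  - subst i; have /NC/subob_inP [n hn] : C (z - g i0 (r i0 z)).
      by rewrite /C linearB rg subrr.
    exists (n, 0); rewrite -[LHS]/(rho i0 (subob_in N i0 n) + rho i0 (om i0 0)).
    by rewrite hn !linear0 addr0 linearB rg0 subr0.
have [l hl] := pP _ _ _ (rep_comp_mor rho de) cS.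
pose mu := rep_comp_mor (dsum_fst _ _) l; pose ta := rep_comp_mor (dsum_snd _ _) l.
pose phi := rep_comp_mor mu ep.
have hphi i n : rho i (nu i (phi i n)) + rho i (om i (ta i (ep i n))) = rho i (nu i n).
  rewrite [LHS](hl i (ep i n)) -[LHS]/(rho i (de i (ep i n))).
  by rewrite -hnu linearB rg0 subr0.
(* W vanishes in degree i0, so the image of [phi n - n] lies both in the image of g and in its
   complement C. *)
have phi0 (n : subob N i0) : phi i0 n = n.
  apply: nuI; apply/eqP; rewrite -subr_eq0; apply/eqP.
  have om0 : om i0 (ta i0 (ep i0 n)) = 0 by have /hW := omW i0 (ta i0 (ep i0 n)); apply.
  have := hphi i0 n; rewrite om0 linear0 addr0 => /eqP.
  rewrite -subr_eq0 -linearB => /eqP/rhoK/hI [y gy].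
  have : r i0 (g i0 y) = 0 by rewrite gy linearB !Nr ?subrr.
  by rewrite rg -gy => ->; rewrite linear0.
(* The fixed points of [phi] form a submodule containing C, hence all of N; so N is a retract of
   P. *)
have [E hE] : exists E : subrep Z, forall i z, E i z <-> exists n, nu i n = z /\ phi i n = n.
  apply: (@mk_subrep _ _ Z (fun i z => exists n, nu i n = z /\ phi i n = n)).
  - by move=> i; exists 0; rewrite !linear0.
  - move=> i a _ _ [x [<- hx]] [y [<- hy]]; exists (a *: x + y).
    by rewrite !linearP hx hy.
  - by move=> i q _ [x [<- hx]]; exists (qact q x); rewrite !mor_qact hx.
have phi1 i n : phi i n = n.
  have /hE [n' [/nuI <- //]] : E i (nu i n).
  apply: ((hN i (nu i n)).1 (nuN i n)) => c /NC/subob_inP [m hm].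
  by apply/hE; exists m; rewrite phi0.
have prN : projinj (subob N).
  by apply: (projinj_retract (i := ep) (p := mu)) => //; apply: phi1.
have /NC/subob_inP [n hn] : C c0 by [].
apply: c0n; rewrite -hn (projinj_subobject_zero npZ nuI prN n).
exact: linear0.
Qed.
End ARTriangle.

Theorem theorem3p3 (k : closedFieldType) (A : falgType k)
  (A_basic : basic_algebra A) (T : translation A) (M M' M'' : repmod A)
  (h : repmor M M') (h' : repmor M' M'') (h'' : repmor M'' (cosyz (T M)))
  (M_np : no_projective_summand M) (M'_np : no_projective_summand M')
  (M''_np : no_projective_summand M'') (AR : AR_triangle h h' h'') :
  [/\ stably_smonic h -> stably_sepic h',
      stably_sepic h -> stably_sirreducible h' &
      stably_sirreducible h -> stably_smonic h' \/ stably_sirreducible h'].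
Proof.
have [dt [iM iM''] _ ras] := AR.
have hh := triangle_zero dt; have wk := triangle_weak_kernel dt.
have wc := triangle_weak_cokernel dt.
have irr' (irr : @irreducible (stabA A) _ _ h) : @irreducible (stabA A) _ _ h'.
  exact: AR_irreducible M_np iM irr hh wk ras.
have adm (irr : @irreducible (stabA A) _ _ h) : stable_admissible h'.
  by split=> //; [exact: irr' irr | right].
have tri (irr : @irreducible (stabA A) _ _ h) : [\/ smonic h', sepic h' | sirreducible h'].
  exact: irreducible_trichotomy (stable_irreducible M'_np M''_np (irr' irr)).
split=> [[[irr _ _ _] sh]|[[irr _ _ _] sh]|[[irr _ _ _] sh]].
- split; first exact: adm.
  exact: smonic_sepic M_np M'_np M''_np iM iM'' irr hh wk wc ras sh.
- split; first exact: adm.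
  have [sm|se|//] := tri irr.
    by case: (sepic_not_smonic M_np M''_np iM irr hh wk ras sh sm).
  (* If h' were sepic, h would be smonic as well as sepic, hence bijective, which irreducibility
     excludes. *)
  have sm := sepic_smonic M_np M'_np iM irr hh wk se.
  by case: (irreducible_not_bij irr (smonic_inj sm) (sepic_surj sh)).
- have [sm|se|si] := tri irr; last by right; split; [exact: adm|].
    by left; split; [exact: adm|].
  (* If h' were sepic, h would be smonic, contrary to its behaviour in degree [i0]. *)
  have [_ [i0 [nm _ _ _]]] := sh.
  by case: nm; apply: (sepic_smonic M_np M'_np iM irr hh wk se).
Qed.
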